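(* Let $r\ge 1$ and $0\le s<r$ be integers, let $b>1$, let $f\in D^{r,1}([0,1])$, and let $\mathcal{L}_r$ be a continuation operator as described in the context. Let $F\in M_{2,r+1}(\mathbb{R})$ be the boundary data matrix of $f$ and let $f_c$ be the continuation of $f$ built from $F$. For each integer $n\ge 1$ let $\hat F=\hat F_n\in M_{2,r+1}(\mathbb{R})$ be a matrix (possibly depending on $n$) that is $s$-exact with respect to $f$, and let $\hat f_c$ be the approximate continuation of $f$ built from $\hat F$. Then there exist positive constants $C_1$ and $C_2$, independent of $n$, such that $$\Vert \mathcal{T}_{n,b}(\hat f_c)-f\Vert_{\infty,[0,1]}\le \frac{C_1}{n^{s+1}}\Vert \hat F-F\Vert_{max}+\frac{C_2}{n^{r+1}}$$ for all $n\ge 1$. In particular, for a real number $p$: if $\Vert \hat F-F\Vert_{max}=\mathcal{O}(1/n^p)$ and $p+s>r$, then $$\Vert \mathcal{T}_{n,b}(\hat f_c)-f\Vert_{\infty,[0,1]}=\mathcal{O}\left(\frac{1}{n^{r+1}}\right),$$ whereas if $\Vert \hat F-F\Vert_{max}=\mathcal{O}(1/n^p)$ and $p+s\le r$, then $$\Vert \mathcal{T}_{n,b}(\hat f_c)-f\Vert_{\infty,[0,1]}=\mathcal{O}\left(\frac{1}{n^{p+s+1}}\right).$$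
   Context: Function spaces. A function $g$ is in $C_{pw}([\alpha,\beta])$ (piecewise continuous) if there are finitely many points $\alpha=a_0<a_1<\dots<a_{n_d}=\beta$ such that each restriction $g|_{(a_j,a_{j+1})}$ extends to a continuous function on $[a_j,a_{j+1}]$. A function $g$ is in $C^{\ell}_{pw}([\alpha,\beta])$ iff $g^{(\ell)}\in C_{pw}([\alpha,\beta])$ (the derivative may fail to exist at finitely many points). $D^{r,1}([\alpha,\beta])=C^r([\alpha,\beta])\cap C^{r+2}_{pw}([\alpha,\beta])$, for real-valued functions. Derivatives at end points are one-sided. Matrices. $M_{2,r+1}(\mathbb{R})$ is the space of real $2\times(r+1)$ matrices, with rows indexed by $j\in\{0,1\}$ and columns by $0\le k\le r$, and norm $\Vert A\Vert_{max}=\max_{j,k}|a_{jk}|$. The boundary data matrix of $f$ is $F=(f^{(k)}(j))_{0\le j\le 1,\,0\le k\le r}$. Continuation operator. $\mathcal{L}_r:M_{2,r+1}(\mathbb{R})\to D^{r,1}([1-b,0])$ is a fixed bounded linear operator satisfying the derivative conditions: for every $A=(a_{jk})\in M_{2,r+1}(\mathbb{R})$ and $0\le\ell\le r$, $(\mathcal{L}_r(A))^{(\ell)}(0)=a_{0\ell}$ and $(\mathcal{L}_r(A))^{(\ell)}(1-b)=a_{1\ell}$. Continuations. $f_c:[1-b,1]\to\mathbb{R}$ is $f_c(x)=f(x)$ for $x\in[0,1]$ and $f_c(x)=\mathcal{L}_r(F)(x)$ for $x\in[1-b,0)$. For $\hat F\in M_{2,r+1}(\mathbb{R})$, $\hat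 f_c:[1-b,1]\to\mathbb{R}$ is $\hat f_c(x)=f(x)$ for $x\in[0,1]$ and $\hat f_c(x)=\mathcal{L}_r(\hat F)(x)$ for $x\in[1-b,0)$. $s$-exactness. For $0\le s<r$, $\hat F=(\hat f_{jk})$ is $s$-exact with respect to $f$ if $\hat f_{jk}=f^{(k)}(j)$ for $j\in\{0,1\}$, $0\le k\le s$, and $\hat f_{j(s+1)}\ne f^{(s+1)}(j)$ for $j=0$ or $j=1$. Truncated Fourier series. For $g$ on $[1-b,1]$, $\mathcal{T}_{n,b}(g)(x)=\sum_{k=-n}^{n}c_k(g)e^{2\pi i kx/b}$ with $c_k(g)=\frac1b\int_{1-b}^1 g(x)e^{-2\pi i kx/b}\,dx$. $\Vert h\Vert_{\infty,[0,1]}=\max_{x\in[0,1]}|h(x)|$. The notation $\mathcal{O}(\cdot)$ refers to $n\to\infty$. *)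

(* Defs.v *)
From HB Require Import structures.
From mathcomp Require Import all_boot all_order all_algebra.
From mathcomp Require Import all_classical all_reals all_analysis.
From mathcomp Require Import complex.

Set Implicit Arguments.
Unset Strict Implicit.
Unset Printing Implicit Defensive.

Import Order.TTheory GRing.Theory Num.Theory.
Import numFieldNormedType.Exports.

Local Open Scope classical_set_scope.
Local Open Scope complex_scope.
Local Open Scope ring_scope.

(* Functions on a compact interval [al, be] are represented by total functions
   R -> R, of which only the values on [al, be] matter. *)

Section Derivatives.
Context {R : realType}.
Implicit Types (al be x : R) (g : R -> R).

(* Difference quotients with y restricted to [al, be]: the limit y --> x is
   two-sided inside the interval and one-sided at its end points. *)
Definition derivable_on al be g x : Prop :=
  cvg ((g y - g x) / (y - x) @[y --> within `[al, be] x^']).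

Definition derive_on al be g x : R :=
  lim ((g y - g x) / (y - x) @[y --> within `[al, be] x^']).

(* As [lim] is total, the values at points where some derivative of order at
   most n fails to exist are meaningless; see [derivablen_at]. *)
Definition deriven_on al be n g : R -> R := iter n (derive_on al be) g.

Definition derivablen_at al be n g x : Prop :=
  forall k, (k < n)%N -> derivable_on al be (deriven_on al be k g) x.

(* C^n([al, be]) *)
Definition Cn al be n g : Prop :=
  {in `[al, be], forall x, derivablen_at al be n g x} /\
  {within `[al, be], continuous (deriven_on al be n g)}.

Definition continuous_extension x y g : Prop :=
  exists h : R -> R, {within `[x, y], continuous h} /\ {in `]x, y[, g =1 h}.

(* C_pw^n([al, be]). The points where a derivative of order at most n fails to
   exist are finitely many, hence can be taken among the partition points. *)
Definition Cn_pw al be n g : Prop :=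
  exists s : seq R, itv_partition al be s /\
    forall i, (i < size s)%N ->
      let x := nth be (al :: s) i in
      let y := nth be (al :: s) i.+1 in
      {in `]x, y[, forall z, derivablen_at al be n g z} /\
      continuous_extension x y (deriven_on al be n g).

(* D^{r,1}([al, be]) *)
Definition Dr1 r al be g : Prop := Cn al be r g /\ Cn_pw al be r.+2 g.

(* The maximum, since this is only used for h continuous on [al, be]. *)
Definition supnorm al be (h : R -> R[i]) : R :=
  sup [set Normc.normc (h x) | x in `[al, be]].

End Derivatives.

Section Continuation.
Context {R : realType}.
Implicit Types (b : R) (f : R -> R).

Definition boundary_data r f : 'M[R]_(2, r.+1) :=
  \matrix_(j < 2, k < r.+1) deriven_on 0 1 k f (j : nat)%:R.

(* Boundedness is required for the uniform norm, the weakest norm in use on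
   D^{r,1}([1 - b, 0]); [mx_norm] is the maximum norm. *)
Definition continuation_operator r b
    (L : 'M[R]_(2, r.+1) -> R -> R) : Prop :=
  [/\ (forall A, Dr1 r (1 - b) 0 (L A)),
      (forall (c : R) A B, {in `[1 - b, 0],
         forall x, L (c *: A + B) x = c * L A x + L B x}),
      (exists M : R, forall A, {in `[1 - b, 0],
         forall x, `|L A x| <= M * mx_norm A}) &
      (forall A (l : 'I_r.+1),
         deriven_on (1 - b) 0 l (L A) 0 = A 0 l /\
         deriven_on (1 - b) 0 l (L A) (1 - b) = A 1 l)].

Definition continuation r (L : 'M[R]_(2, r.+1) -> R -> R) f
    (A : 'M[R]_(2, r.+1)) : R -> R :=
  fun x => if x < 0 then L A x else f x.

Definition s_exact r s f (A : 'M[R]_(2, r.+1)) : Prop :=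
  (forall (j : 'I_2) (k : 'I_r.+1), (k <= s)%N ->
     A j k = deriven_on 0 1 k f (j : nat)%:R) /\
  (exists (j : 'I_2) (k : 'I_r.+1), (k : nat) = s.+1 /\
     A j k <> deriven_on 0 1 k f (j : nat)%:R).

End Continuation.

Section Fourier.
Context {R : realType}.
Implicit Types (b x : R) (g : R -> R).

(* e^{i t} *)
Definition expi (t : R) : R[i] := cos t +i* sin t.

Definition cintegral (D : set R) (h : R -> R[i]) : R[i] :=
  (\int[lebesgue_measure]_(x in D) complex.Re (h x)) +i*
  (\int[lebesgue_measure]_(x in D) complex.Im (h x)).

Definition fourier_coef b g (k : int) : R[i] :=
  (b^-1)%:C * cintegral `[1 - b, 1]
    (fun x => (g x)%:C * expi (- (2 * pi * k%:~R * x / b))).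

(* The index i : 'I_(2n + 1) stands for the frequency k = i - n. *)
Definition fourier_trunc n b g x : R[i] :=
  \sum_(i < n.*2.+1) let k := i%:Z - n%:Z in
    fourier_coef b g k * expi (2 * pi * k%:~R * x / b).

End Fourier.

(* Main.v *)
Require Import Defs.
From HB Require Import structures.
From mathcomp Require Import all_boot all_order all_algebra.
From mathcomp Require Import all_classical all_reals all_analysis.
From mathcomp Require Import measurable_realfun complex zify ring lra.

Set Implicit Arguments.
Unset Strict Implicit.
Unset Printing Implicit Defensive.

Import Order.TTheory GRing.Theory Num.Theory.
Import numFieldNormedType.Exports.

Local Open Scope classical_set_scope.
Local Open Scope complex_scope.
Local Open Scope ring_scope.

(** The error splits as
      T_n(fhat_c) - f = (T_n(f_c) - f) + T_n(fhat_c - f_c)   on [0, 1],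
    because fhat_c and f_c coincide with f there. Both functions f_c and
    fhat_c - f_c are obtained by splicing a function u on [1 - b, 0] with a
    function v on [0, 1], both smooth up to order r and piecewise smooth up to
    order r + 2; for f_c the periodic extension has matching derivatives up to
    order r, while for fhat_c - f_c, where v = 0, s-exactness gives matching up
    to order s. Both terms are therefore governed by one estimate,
    [splice_partial_sum_rate]: if the derivatives match up to order q, the
    truncated series differs from v on [0, 1] by O(1 / n ^ (q + 1)).

    For this estimate, the integral of the spliced function against a wave of
    frequency k is expanded by repeated integration by parts on both intervals
    ([Rintegral_wave_bound]). By periodicity the boundary terms of order at most
    q cancel ([sum_boundary_terms_bound]), so the coefficients are
    O(1 / k ^ (q + 2)) ([splice_fourier_bound]) and the tail of the series is
    O(1 / n ^ (q + 1)). It remains to know that the series converges to the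
    function. The spliced function is Lipschitz and periodic, so that the
    difference between the partial sum and the value at x is, by Dirichlet's
    formula, a coefficient of a bounded function in an orthogonal family
    ([partial_sum_error]), and tends to 0 by Bessel's inequality
    ([partial_sum_cvg]).

    To make the constant in front of the norm of Fhat - F independent of n,
    L (Fhat - F) is written as a combination of the finitely many functions
    L E_jk, where E_jk is a matrix unit in a column k > s, each of which has its
    own constant ([approximate_continuation_rate]).

    All computations are done with real waves: the terms of frequencies k and
    - k add up to a real number ([fourier_truncE]). *)

(** * Derivatives relative to a compact interval *)

Section RelativeDerivatives.
Context {R : realType}.
Implicit Types (al be x : R) (g : R -> R).

(** The limit in its epsilon-delta form, from which both the continuity of [g]
    relative to the interval and the comparison with the two-sided derivative
    are read off. *)
Lemma derivable_on_quotient al be g x : derivable_on al be g x ->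
  forall e, 0 < e -> exists2 d, 0 < d & forall y, al <= y <= be -> y != x ->
    `|x - y| < d -> `|derive_on al be g x - (g y - g x) / (y - x)| <= e.
Proof.
move=> gx e e0; have /cvgrPdist_le/(_ _ e0) := gx.
rewrite near_withinE /dnbhs near_withinE => -[d /= d0 H].
by exists d => // y yab yx xy; apply: H => //.
Qed.

Lemma derivable_on_continuous al be g x : derivable_on al be g x ->
  g y @[y --> within `[al, be] (nbhs x)] --> g x.
Proof.
move=> gx; have [d d0 H] := derivable_on_quotient gx ltr01.
set l := derive_on al be g x in H; have l0 : 0 < `|l| + 1 by rewrite ltr_wpDl.
apply/cvgrPdist_le => e e0; rewrite near_withinE.
exists (Num.min d ((`|l| + 1)^-1 * e)).
  by rewrite /= lt_min d0 mulr_gt0// invr_gt0.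
move=> y /=; rewrite lt_min in_itv/= => /andP[yd ye] yab.
have [->|yx] := eqVneq y x; first by rewrite subrr normr0 ltW.
have yx0 : y - x != 0 by rewrite subr_eq0.
have {}H : `|(g y - g x) / (y - x)| <= `|l| + 1.
  rewrite -[X in `|X|](subKr l); apply: le_trans (ler_normB _ _) _.
  by rewrite lerD2l; exact: H.
rewrite distrC -[g y - g x](divfK yx0) normrM.
apply: le_trans (ler_wpM2r _ H) _ => //.
by rewrite -ler_pdivlMl// distrC ltW.
Qed.

Lemma derivable_on_is_derive al be g x : al < x < be -> derivable_on al be g x ->
  is_derive x 1 g (derive_on al be g x).
Proof.
move=> /andP[alx xbe] gx.
have H : h^-1 *: (g (h *: 1 + x) - g x) @[h --> (0 : R)^'] --> derive_on al be g x.
  apply/cvgrPdist_le => e e0; have [d d0 H] := derivable_on_quotient gx e0.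
  have hs (k : R) : 0 < k -> \forall h \near (0 : R)^', `|h| < k.
    by move=> k0; exact: dnbhs0_lt.
  near=> h.
  have h0 : h != 0 by near: h; exact: nbhs_dnbhs_neq.
  rewrite [h *: 1]mulr1.
  have -> : h^-1 *: (g (h + x) - g x) = (g (h + x) - g x) / (h + x - x).
    by rewrite addrK mulrC.
  apply: H.
  - have : `|h| < x - al by near: h; apply: hs; rewrite subr_gt0.
    have : `|h| < be - x by near: h; apply: hs; rewrite subr_gt0.
    by rewrite !ltr_norml => /andP[? ?] /andP[? ?]; apply/andP; split; lra.
  - by rewrite -subr_eq0 addrK.
  - by rewrite distrC addrK; near: h; apply: hs.
apply: DeriveDef; first by apply/cvg_ex; exists (derive_on al be g x).
by rewrite /derive; exact/cvg_lim.
Unshelve. all: by end_near. Qed.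

(** The value of the limit is determined because [x] is an accumulation point
    of the interval, which is where [al < be] comes in. *)
Lemma derive_on_eq0 al be g x : al < be -> al <= x <= be ->
  {in `[al, be], forall y, g y = 0} ->
  derivable_on al be g x /\ derive_on al be g x = 0.
Proof.
move=> albe xab g0.
(* Every punctured ball around x meets the interval: on the right of x if
   x < be, on the left of x otherwise. *)
have FF : ProperFilter (within `[al, be] x^').
  split=> [|]; last exact: within_filter.
  rewrite /within/= /dnbhs => -[d /= d0 H].
  have d20 : 0 < d / 2 by rewrite divr_gt0.
  have dd : d / 2 < d by rewrite ltr_pdivrMr// ltr_pMr// ltr1n.
  have [xb|xb] := ltP x be.
  - pose m := Num.min (d / 2) (be - x).
    have m0 : 0 < m by rewrite lt_min d20 subr_gt0.
    have : m <= be - x by rewrite ge_min lexx orbT.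
    have : m <= d / 2 by rewrite ge_min lexx.
    move=> md mb; apply: (H (x + m)) => /=.
    + by rewrite opprD addrA subrr sub0r normrN gtr0_norm//; lra.
    + by rewrite -subr_eq0 addrAC subrr add0r gt_eqF.
    + by rewrite in_itv/=; case/andP: xab => ? ?; apply/andP; split; lra.
  - pose m := Num.min (d / 2) (x - al).
    have m0 : 0 < m by rewrite lt_min d20 subr_gt0; lra.
    have : m <= x - al by rewrite ge_min lexx orbT.
    have : m <= d / 2 by rewrite ge_min lexx.
    move=> md mb; apply: (H (x - m)) => /=.
    + by rewrite opprB addrC subrK gtr0_norm//; lra.
    + by rewrite -subr_eq0 addrAC subrr sub0r oppr_eq0 gt_eqF.
    + by rewrite in_itv/=; case/andP: xab => ? ?; apply/andP; split; lra.
have q0 : (g y - g x) / (y - x) @[y --> within `[al, be] x^'] --> (0 : R).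
  apply/cvgrPdist_le => e e0; rewrite near_withinE; near=> y => /= yab.
  by rewrite (g0 y)// (g0 x) ?in_itv//= subrr mul0r subr0 normr0 ltW.
split; first by apply/cvg_ex; exists 0.
exact/cvg_lim.
Unshelve. all: by end_near. Qed.

Lemma deriven_on_eq0 al be g n : al < be ->
  {in `[al, be], forall y, g y = 0} ->
  {in `[al, be], forall y, deriven_on al be n g y = 0}.
Proof.
move=> albe g0; elim: n => [//|n ih] x xab /=.
by have [] := derive_on_eq0 albe xab ih.
Qed.

Lemma derivablen_at_eq0 al be g n : al < be ->
  {in `[al, be], forall y, g y = 0} ->
  {in `[al, be], forall y, derivablen_at al be n g y}.
Proof.
move=> albe g0 x xab k _.
by have [] := derive_on_eq0 albe xab (deriven_on_eq0 k albe g0).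
Qed.

Lemma Dr1_eq0 al be g r : al < be -> {in `[al, be], forall y, g y = 0} ->
  Dr1 r al be g.
Proof.
move=> albe g0.
split; first split; first exact: derivablen_at_eq0.
  apply: (@subspace_eq_continuous _ _ _ (cst 0)) => [y /set_mem/= yab|x].
    by apply/esym/deriven_on_eq0.
  exact: cst_continuous.
exists [:: be]; split; first exact: itv_partition1.
move=> i; rewrite ltnS leqn0 => /eqP -> /=; split.
  by move=> z zab; apply: derivablen_at_eq0 => //; exact: subset_itv_oo_cc.
exists (cst 0); split; first by move=> x; exact: cst_continuous.
move=> z zab; apply: (deriven_on_eq0 r.+2 albe g0).
exact: subset_itv_oo_cc.
Qed.

Variables (al be : R) (r : nat) (g : R -> R).
Hypothesis gr : Cn al be r g.

Lemma Cn_continuous l : (l <= r)%N ->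
  {within `[al, be], continuous (deriven_on al be l g)}.
Proof.
case: gr => gd gc; rewrite leq_eqVlt => /predU1P[-> //|lr].
apply/subspace_continuousP => x xab; apply: derivable_on_continuous.
exact: gd.
Qed.

Lemma Cn_is_derive l x : (l < r)%N -> x \in `]al, be[ ->
  is_derive x 1 (deriven_on al be l g) (deriven_on al be l.+1 g x).
Proof.
case: gr => gd _ lr xab; apply: derivable_on_is_derive; first by [].
by apply: gd => //; exact: subset_itv_oo_cc.
Qed.

End RelativeDerivatives.

(** * Integration by parts against waves of high frequency *)

Section Integrals.
Context {R : realType}.
Notation mu := (@lebesgue_measure R).
Implicit Types (a b : R) (f : R -> R).

Lemma within_continuous_integrable a b f : {within `[a, b], continuous f} ->
  mu.-integrable `[a, b] (EFin \o f).
Proof. by move=> cf; apply: continuous_compact_integrable => //; exact: segment_compact. Qed.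

Lemma within_continuous_bounded a b f : {within `[a, b], continuous f} ->
  exists2 M : R, 0 <= M & forall x, a <= x <= b -> `|f x| <= M.
Proof.
move=> cf; have /compact_bounded : compact (f @` `[a, b]).
  by apply: continuous_compact => //; exact: segment_compact.
move=> [M [_ HM]]; exists (`|M| + 1) => // x xab.
have MM : M < `|M| + 1 by rewrite ltr_pwDr// ler_norm.
by apply: (HM _ MM); exists x.
Qed.

Lemma lebesgue_measure_segment a b : a <= b -> mu `[a, b] = (b - a)%:E.
Proof.
move=> ab; rewrite lebesgue_measure_itv/= lte_fin.
by case: ltgtP ab => // [-> _]; rewrite subrr.
Qed.

Lemma normr_Rintegral_le a b f M : a <= b -> mu.-integrable `[a, b] (EFin \o f) ->
  (forall x, a <= x <= b -> `|f x| <= M) ->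
  `|\int[mu]_(x in `[a, b]) f x| <= M * (b - a).
Proof.
move=> ab fi fM; apply: le_trans (le_normr_Rintegral _ fi) _ => //.
have mab : measurable (`[a, b] : set R) by [].
have -> : M * (b - a) = \int[mu]_(x in `[a, b]) M.
  by rewrite Rintegral_cst//; congr (_ * _); rewrite -[LHS]/(fine (b - a)%:E) -lebesgue_measure_segment.
apply: le_Rintegral => //; first exact: integrable_norm.
  by apply: (@within_continuous_integrable _ _ (cst M)) => x; exact: cst_continuous.
Qed.

Lemma Rintegral_segment_split a b x f : mu.-integrable `[a, b] (EFin \o f) ->
  a <= x <= b -> \int[mu]_(t in `[a, b]) f t =
    \int[mu]_(t in `[a, x]) f t + \int[mu]_(t in `[x, b]) f t.
Proof.
move=> fi /andP[ax xb].
have := @Rintegral_itvB _ f (BLeft a) (BRight b) x fi.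
rewrite !bnd_simp => /(_ ax xb) /eqP; rewrite subr_eq => /eqP ->.
rewrite addrC Rintegral_itv_obnd_cbnd//.
apply: integrableS fi => // y /=; rewrite !in_itv/= => /andP[xy ->].
by rewrite andbT (le_trans ax)// ltW.
Qed.

Lemma Rintegral_parts (F f G g : R -> R) a b : a < b ->
  {within `[a, b], continuous F} -> {within `[a, b], continuous f} ->
  {in `]a, b[, forall x : R, is_derive x 1 F (f x)} ->
  continuous g -> (forall x : R, is_derive x 1 G (g x)) ->
  \int[mu]_(x in `[a, b]) (F x * g x) =
    F b * G b - F a * G a - \int[mu]_(x in `[a, b]) (f x * G x).
Proof.
move=> ab cF cf dF cg dG.
have cG x : G y @[y --> x] --> G x.
  by apply/differentiable_continuous/derivable1_diffP; exact: ex_derive.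
apply: Rintegration_by_parts => //.
- move/continuous_within_itvP : cF => /(_ ab)[cF Fa Fb]; split => //.
  by move=> x /dF ?; exact: ex_derive.
- by move=> x /dF ?; rewrite derive1E derive_val.
- exact: continuous_subspaceT.
- split; first by move=> x _; exact: ex_derive.
  + exact: cvg_at_right_filter.
  + exact: cvg_at_left_filter.
- by move=> x _; rewrite derive1E derive_val.
Qed.

(** The [l]-fold antiderivative of [cos (w t - c)] that is itself a wave:
    integrating a cosine delays its phase by a quarter turn and divides its
    amplitude by [w]. With sine and cosine merged in this way, one rule of
    integration by parts covers every step. *)
Definition wave (w c : R) (l : nat) (t : R) : R :=
  cos (w * t - c - l%:R * (pi / 2)) / w ^+ l.

Lemma is_derive_wave (w c : R) l (x : R) : w != 0 ->
  is_derive x 1 (wave w c l.+1) (wave w c l x).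
Proof.
move=> w0.
have H : is_derive x 1 (fun t => w * t - c - l.+1%:R * (pi / 2)) w.
  by apply: is_derive_eq; rewrite !subr0 scaler1 /=.
have -> : wave w c l.+1 =
    (w ^- l.+1) \*: (cos \o (fun t => w * t - c - l.+1%:R * (pi / 2))).
  by apply/funext => t; rewrite /wave /= mulrC.
apply: is_derive_eq.
rewrite /wave -natr1 mulrDl mul1r opprD addrA sinBpihalf.
by rewrite /GRing.scale/= opprK exprS; field; rewrite expf_neq0.
Qed.

Lemma continuous_wave w c l : continuous (wave w c l).
Proof.
move=> x; rewrite /wave; apply: cvgM; last exact: cvg_cst.
apply: continuous_comp; last exact: continuous_cos.
by apply: cvgB; [apply: cvgB; [apply: cvgM => //; exact: cvg_cst|exact: cvg_cst]|exact: cvg_cst].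
Qed.

Lemma normr_wave_le w c l t : 0 < w -> `|wave w c l t| <= w ^- l.
Proof.
move=> w0; rewrite /wave normrM [X in _ * X]gtr0_norm ?invr_gt0 ?exprn_gt0//.
by rewrite ler_piMl ?cos_max// invr_ge0 exprn_ge0// ltW.
Qed.

Lemma within_continuous_wave a b f w c l : {within `[a, b], continuous f} ->
  {within `[a, b], continuous (fun t => f t * wave w c l t)}.
Proof.
move=> cf; move=> x; apply: cvgM; first exact: cf.
exact: (@continuous_subspaceT _ _ _ _ (@continuous_wave w c l)).
Qed.

End Integrals.

Section PiecewiseC2.
Context {R : realType}.
Notation mu := (@lebesgue_measure R).
Implicit Types (a b : R) (F : R -> R).

(** Integrating [F] times a wave by parts once leaves a remainder one order
    smaller than the boundary term itself. The bound is uniform in the phase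
    [c], since [c] is later a multiple of the point at which the Fourier series
    is evaluated. *)
Definition parts_bound F l a b : Prop := exists2 K, 0 <= K &
  forall w c : R, 0 < w ->
    `|\int[mu]_(t in `[a, b]) (F t * wave w c l t) -
      (F b * wave w c l.+1 b - F a * wave w c l.+1 a)| <= K / w ^+ l.+2.

(** [F] is known only inside the interval, but it differs there by a constant
    from the integral of [H], which is continuous up to the end points. Hence
    a bounded derivative of order r + 2 endows the derivative of order r + 1
    with the end point values that a further integration by parts needs. *)
Lemma antiderivative_within a b (H F : R -> R) : a < b ->
  {within `[a, b], continuous H} ->
  {in `]a, b[, forall x : R, is_derive x 1 F (H x)} ->
  exists2 E : R -> R, {within `[a, b], continuous E} & {in `]a, b[, F =1 E}.
Proof.
move=> ab cH dF.
have iH := within_continuous_integrable cH.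
pose P z := \int[mu]_(t in `[a, z]) H t.
have cP : {within `[a, b], continuous P}.
  exact: parameterized_integral_continuous (ltW ab) iH.
have dP : {in `]a, b[, forall x : R, is_derive x 1 P (H x)}.
  move=> x xab; have /andP[ax xb] : a < x < b by rewrite in_itv in xab.
  have Hx := within_continuous_continuous ab cH xab.
  have [? dPx] := continuous_FTC1_closed xb iH ax Hx.
  by rewrite derive1E in dPx; exact: DeriveDef dPx.
pose m := (a + b) / 2; have mab : m \in `]a, b[ by rewrite in_itv/= /m; apply/andP; split; lra.
exists (fun z => F m - P m + P z).
  by move=> x; apply: cvgD; [exact: cvg_cst|exact: cP].
have dD x y : x \in `]a, b[ -> y \in `]a, b[ -> x <= y -> F x - P x = F y - P y.
  rewrite !in_itv/= => /andP[ax xb] /andP[ay yb] xy.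
  have sub z : z \in `[x, y] -> z \in `]a, b[.
    by rewrite !in_itv/= => /andP[xz zy]; rewrite (lt_le_trans ax)// (le_lt_trans zy).
  have dG z : z \in `[x, y] -> is_derive z 1 (F \- P) 0.
    move=> /sub zab; have dFz := dF z zab; have dPz := dP z zab.
    by apply: is_derive_eq; rewrite subrr.
  have dG' z : z \in `]x, y[ -> is_derive z 1 (F \- P) 0.
    by move=> zxy; apply: dG; exact: subset_itv_oo_cc.
  have cG : {within `[x, y], continuous (F \- P)}.
    by apply: derivable_within_continuous => z /dG dz; exact: (@ex_derive _ _ _ _ _ _ _ dz).
  have [z zxy] := @MVT_segment R (F \- P) (fun=> 0) x y xy dG' cG.
  by rewrite mul0r => /eqP; rewrite subr_eq0 => /eqP/esym.
move=> z zab; have [mz|zm] := leP m z.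
  by rewrite (dD m z)// subrK.
by rewrite -(dD z m) ?subrK// ltW.
Qed.

(** Two integrations by parts: the first produces the boundary term of
    [parts_bound], the second shows that what remains has the size of [F1] and
    [F2] times the amplitude of the wave of index [l + 2]. *)
Lemma parts_bound_piece (F F1 F2 H : R -> R) l a b : a < b ->
  {within `[a, b], continuous F} ->
  {in `]a, b[, forall x : R, is_derive x 1 F (F1 x)} ->
  {in `]a, b[, forall x : R, is_derive x 1 F1 (F2 x)} ->
  {within `[a, b], continuous H} -> {in `]a, b[, F2 =1 H} ->
  parts_bound F l a b.
Proof.
move=> ab cF dF dF1 cH F2H.
have [|E cE F1E] := @antiderivative_within a b H F1 ab cH.
  by move=> x xab; rewrite -F2H//; exact: dF1.
have dF' : {in `]a, b[, forall x : R, is_derive x 1 F (E x)}.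
  by move=> x xab; rewrite -F1E//; exact: dF.
have dE : {in `]a, b[, forall x : R, is_derive x 1 E (H x)}.
  move=> x xab; rewrite -F2H//.
  have dF1x := dF1 x xab.
  apply: (@near_eq_is_derive _ _ _ F1) => //.
  by have := near_in_itvoo xab; apply: filterS => z /F1E.
have [M1 M10 hM1] := within_continuous_bounded cE.
have [M2 M20 hM2] := within_continuous_bounded cH.
have aab : a <= a <= b by rewrite lexx ltW.
have bab : a <= b <= b by rewrite lexx ltW.
exists (M1 + M1 + M2 * (b - a)) => [|w c w0].
  by rewrite !addr_ge0// mulr_ge0// subr_ge0 ltW.
have wn0 : w != 0 by rewrite gt_eqF.
have wl k : 0 < w ^- k by rewrite invr_gt0 exprn_gt0.
have dW k (x : R) : is_derive x 1 (wave w c k.+1) (wave w c k x) by exact: is_derive_wave.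
rewrite (Rintegral_parts ab cF cE dF' (@continuous_wave _ w c l) (dW l)).
rewrite (Rintegral_parts ab cE cH dE (@continuous_wave _ w c l.+1) (dW l.+1)).
rewrite addrC addKr normrN.
rewrite !mulrDl; apply: le_trans (ler_normB _ _) _; apply: lerD.
  apply: le_trans (ler_normB _ _) _; rewrite (normrM (E b)) (normrM (E a)); apply: lerD.
    by apply: ler_pM => //; [exact: hM1|exact: normr_wave_le].
  by apply: ler_pM => //; [exact: hM1|exact: normr_wave_le].
rewrite mulrAC; apply: normr_Rintegral_le => [||x xab]; first exact: ltW.
  exact/within_continuous_integrable/within_continuous_wave.
by rewrite normrM; apply: ler_pM => //; [exact: hM2|exact: normr_wave_le].
Qed.

(** The boundary terms at the common point cancel, so that a jump of the
    derivatives of [F] costs nothing to this order. *)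
Lemma parts_bound_cat F l a b x : a <= x <= b ->
  {within `[a, b], continuous F} ->
  parts_bound F l a x -> parts_bound F l x b -> parts_bound F l a b.
Proof.
move=> axb cF [K K0 HK] [K' K'0 HK'].
exists (K + K') => [|w c w0]; first exact: addr_ge0.
rewrite (@Rintegral_segment_split _ a b x)//; last first.
  exact/within_continuous_integrable/within_continuous_wave.
rewrite mulrDl.
apply: le_trans (lerD (HK w c w0) (HK' w c w0)); apply: le_trans (ler_normD _ _).
by rewrite le_eqVlt; apply/orP; left; apply/eqP; congr (`|_|); ring.
Qed.

Lemma parts_bound_refl F l a : parts_bound F l a a.
Proof.
exists 0 => // w c w0; rewrite set_itv1 Rintegral_set1 !subrr normr0.
by rewrite mul0r.
Qed.

Lemma parts_bound_partition F l a b s : itv_partition a b s ->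
  {within `[a, b], continuous F} ->
  (forall i, (i < size s)%N ->
    parts_bound F l (nth b (a :: s) i) (nth b (a :: s) i.+1)) ->
  parts_bound F l a b.
Proof.
elim: s a => [a /itv_partition_nil -> _ _|x s ih a abs cF H].
  exact: parts_bound_refl.
have xbs := itv_partition_cons abs.
have ax : a <= x by case: abs => /= /andP[/ltW].
have xb := itv_partition_le xbs.
apply: (@parts_bound_cat _ _ _ _ x) => //; first by rewrite ax xb.
  exact: (H 0%N).
apply: ih => // [|i si]; last exact: (H i.+1).
apply: continuous_subspaceW cF => y /=; rewrite !in_itv/= => /andP[xy ->].
by rewrite (le_trans ax).
Qed.

End PiecewiseC2.

Section BoundaryExpansion.
Context {R : realType}.
Notation mu := (@lebesgue_measure R).
Variables (al be : R) (r : nat) (g : R -> R).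
Hypotheses (albe : al < be) (gr : Dr1 r al be g).
Let G l := deriven_on al be l g.

Lemma Dr1_parts_bound : parts_bound (G r) r al be.
Proof.
have [gC [s [abs gs]]] := gr.
apply: (parts_bound_partition abs); first exact: Cn_continuous gC _ _.
move=> i si; have [/= dg [h [ch gh]]] := gs i si.
set x := nth be (al :: s) i in dg ch gh *; set y := nth be s i in dg ch gh *.
have xy : x < y.
  have [ap _] := abs; rewrite /x /y; move/(pathP be): ap => /(_ i si).
  by [].
have alx : al <= x by apply: itv_partition_nth_ge => //; exact: ltnW.
have ybe : y <= be by apply: (itv_partition_nth_le (m := i.+1) _ abs).
have sub z : z \in `]x, y[ -> al < z < be.
  rewrite in_itv/= => /andP[xz zy].
  by rewrite (le_lt_trans alx xz) (lt_le_trans zy ybe).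
apply: (@parts_bound_piece _ _ (G r.+1) (G r.+2) h) => //.
- apply: continuous_subspaceW (Cn_continuous gC (leqnn r)) => z /=.
  by rewrite !in_itv/= => /andP[xz zy]; rewrite (le_trans alx) ?(le_trans zy).
- by move=> z zxy; apply: derivable_on_is_derive; [exact: sub|exact: dg].
- by move=> z zxy; apply: derivable_on_is_derive; [exact: sub|exact: dg].
Qed.

Definition boundary_term w c l : R :=
  (-1) ^+ l * (G l be * wave w c l.+1 be - G l al * wave w c l.+1 al).

(** Inside the interval [g] has [r] derivatives without exceptional points, so
    that integration by parts can be repeated globally. *)
Lemma Rintegral_wave_expansion w c j : 0 < w -> (j <= r)%N ->
  \int[mu]_(t in `[al, be]) (g t * wave w c 0 t) =
  \sum_(l < j) boundary_term w c l +
  (-1) ^+ j * \int[mu]_(t in `[al, be]) (G j t * wave w c j t).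
Proof.
move=> w0; have wn0 : w != 0 by rewrite gt_eqF.
have [gC _] := gr.
elim: j => [_|j ih jr]; first by rewrite big_ord0 add0r expr0 mul1r.
rewrite ih; last exact: ltnW.
rewrite big_ord_recr/= -addrA; congr (_ + _).
have dW (x : R) : is_derive x 1 (wave w c j.+1) (wave w c j x) by exact: is_derive_wave.
have dG : {in `]al, be[, forall x : R, is_derive x 1 (G j) (G j.+1 x)}.
  by move=> x xab; exact: (Cn_is_derive gC jr xab).
have cG k : (k <= r)%N -> {within `[al, be], continuous (G k)}.
  by move=> kr; exact (Cn_continuous gC kr).
rewrite (Rintegral_parts albe (cG _ (ltnW jr)) (cG _ jr) dG (@continuous_wave _ w c j) dW).
by rewrite /boundary_term mulrBr exprS mulN1r mulNr.
Qed.

(** The last integration by parts is the piecewise one. *)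
Lemma Rintegral_wave_bound : exists2 K, 0 <= K & forall w c : R, 0 < w ->
  `|\int[mu]_(t in `[al, be]) (g t * wave w c 0 t) -
    \sum_(l < r.+1) boundary_term w c l| <= K / w ^+ r.+2.
Proof.
have [K K0 HK] := Dr1_parts_bound; exists K => // w c w0.
rewrite (@Rintegral_wave_expansion w c r)// big_ord_recr/= opprD addrACA subrr add0r.
by rewrite -mulrBr normrM normrX normrN1 expr1n mul1r HK.
Qed.

End BoundaryExpansion.

(** * Gluing two smooth functions into a periodic one *)

Section Frequencies.
Context {R : realType}.
Notation mu := (@lebesgue_measure R).
Variable b : R.
Hypothesis hb : 1 < b.

Let b0 : 0 < b. Proof. exact: lt_trans hb. Qed.

Definition freq (k : nat) : R := 2 * pi * k%:R / b.

Lemma freqM k : freq k = 2 * pi / b * k%:R.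
Proof. by rewrite /freq mulrAC. Qed.

Lemma freq_gt0 k : (0 < k)%N -> 0 < freq k.
Proof. by move=> k0; rewrite /freq divr_gt0// !mulr_gt0 ?ltr0n// pi_gt0. Qed.

Lemma wave_period k c l : wave (freq k) c l 1 = wave (freq k) c l (1 - b).
Proof.
rewrite /wave; congr (_ / _); set y := _ * (1 - b) - c - _.
rewrite -(periodicn (@cosD2pi R) k y); congr cos.
by rewrite /y /freq -mulr_natr -[pi *+ 2]mulr_natr; field; rewrite gt_eqF.
Qed.

Lemma Rintegral_wave0 k c : (0 < k)%N ->
  \int[mu]_(t in `[1 - b, 1]) wave (freq k) c 0 t = 0.
Proof.
move=> k0; have w0 : freq k != 0 by rewrite gt_eqF// freq_gt0.
have ab : 1 - b < 1 by rewrite gtrBl.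
have cc (z : R) : {within `[1 - b, 1], continuous (cst z : R -> R)}.
  by move=> x; exact: cst_continuous.
have d1 : {in `]1 - b, 1[, forall x : R, is_derive x 1 (cst 1 : R -> R) (cst 0 x)}.
  by move=> x _; exact: is_derive_cst.
have dW (x : R) := is_derive_wave c 0 x w0.
have := Rintegral_parts ab (cc 1) (cc 0) d1 (@continuous_wave _ (freq k) c 0) dW.
rewrite /= wave_period subrr sub0r.
under eq_Rintegral do rewrite mul1r.
under [in RHS]eq_Rintegral do rewrite mul0r.
by rewrite Rintegral_cst// mul0r oppr0.
Qed.

End Frequencies.

Section Lipschitz.
Context {R : realType}.

Lemma Cn_lipschitz al be r (g : R -> R) : Cn al be r g -> (1 <= r)%N ->
  exists2 M : R, 0 <= M & forall x y, al <= x <= be -> al <= y <= be ->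
    `|g x - g y| <= M * `|x - y|.
Proof.
move=> gr r1; have [M M0 HM] := within_continuous_bounded (Cn_continuous gr r1).
exists M => //.
have H x y : al <= x -> x <= y -> y <= be -> `|g x - g y| <= M * `|x - y|.
  move=> ax xy yb; have cg : {within `[x, y], continuous g}.
    apply: continuous_subspaceW (Cn_continuous gr (leq0n r)) => z /=.
    by rewrite !in_itv/= => /andP[xz zy]; rewrite (le_trans ax) ?(le_trans zy).
  have dg z : z \in `]x, y[ -> is_derive z 1 g (deriven_on al be 1 g z).
    rewrite in_itv/= => /andP[xz zy]; apply: (Cn_is_derive gr r1).
    by rewrite in_itv/= (le_lt_trans ax) ?(lt_le_trans zy).
  have [z zxy gE] := MVT_segment xy dg cg.
  rewrite distrC gE normrM (distrC x y) ler_wpM2r// HM//.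
  move: zxy; rewrite in_itv/= => /andP[xz zy].
  by rewrite (le_trans ax) ?(le_trans zy).
move=> x y /andP[ax xb] /andP[ay yb].
have [xy|/ltW yx] := leP x y; first exact: H.
by rewrite distrC (distrC x y); exact: H.
Qed.

End Lipschitz.

Section Splice.
Context {R : realType}.
Notation mu := (@lebesgue_measure R).
Implicit Types u v : R -> R.

(** The function equal to [u] on the extension [1 - b, 0] and to [v] on
    [0, 1]; continuations have this form. *)
Definition splice u v : R -> R := fun x => if x < 0 then u x else v x.

Variables (b : R) (r q : nat) (u v : R -> R).
Hypotheses (hb : 1 < b) (r1 : (1 <= r)%N) (qr : (q <= r)%N).
Hypotheses (ur : Dr1 r (1 - b) 0 u) (vr : Dr1 r 0 1 v).
Hypothesis match0 : forall l, (l <= q)%N ->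
  deriven_on (1 - b) 0 l u 0 = deriven_on 0 1 l v 0.
Hypothesis match1 : forall l, (l <= q)%N ->
  deriven_on (1 - b) 0 l u (1 - b) = deriven_on 0 1 l v 1.

Let g := splice u v.
Let b10 : 1 - b < 0. Proof. by rewrite subr_lt0. Qed.
Let b0 : 0 < b. Proof. exact: lt_trans hb. Qed.

Lemma spliceL x : x <= 0 -> g x = u x.
Proof.
rewrite /g /splice; case: ltgtP => // -> _.
by have /= -> := match0 (leq0n q).
Qed.

Lemma spliceR x : 0 <= x -> g x = v x.
Proof. by rewrite /g /splice; case: ltgtP. Qed.

Lemma splice_period : g (1 - b) = g 1.
Proof. by rewrite spliceL ?ltW// spliceR//; exact: (match1 (leq0n q)). Qed.

Lemma splice_continuous : {within `[1 - b, 1], continuous g}.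
Proof.
have -> : `[1 - b, 1]%classic = `[1 - b, 0] `|` `[0, 1].
  apply/seteqP; split=> x /=; rewrite !in_itv/=; last first.
    case=> /andP[x1 x2]; first by rewrite x1 (le_trans x2).
    by rewrite x2 (le_trans (ltW b10)).
  by move=> /andP[-> ->]; rewrite andbT; apply/orP; exact: le_total.
apply: withinU_continuous; [exact: itv_closed|exact: itv_closed| |].
- apply: (@subspace_eq_continuous _ _ _ u) (Cn_continuous ur.1 (leq0n r)).
  by move=> x /set_mem/=; rewrite in_itv/= => /andP[_ x0]; apply/esym/spliceL.
- apply: (@subspace_eq_continuous _ _ _ v) (Cn_continuous vr.1 (leq0n r)).
  by move=> x /set_mem/=; rewrite in_itv/= => /andP[x0 _]; apply/esym/spliceR.
Qed.

(** Two points on different sides of 0 are compared through the common value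
    at 0. *)
Lemma splice_lipschitz : exists2 M : R, 0 <= M & forall x y,
  1 - b <= x <= 1 -> 1 - b <= y <= 1 -> `|g x - g y| <= M * `|x - y|.
Proof.
have [M M0 HM] := Cn_lipschitz ur.1 r1.
have [N N0 HN] := Cn_lipschitz vr.1 r1.
exists (M + N); first exact: addr_ge0.
have H x y : 1 - b <= x -> x <= y -> y <= 1 -> `|g x - g y| <= (M + N) * `|x - y|.
  move=> bx xy y1; have xyN : `|x - y| = y - x by rewrite distrC ger0_norm// subr_ge0.
  have [y0|/ltW y0] := leP y 0.
    rewrite !spliceL//; last exact: le_trans xy y0.
    apply: le_trans (HM _ _ _ _) _; first by apply/andP; split; lra.
      by apply/andP; split; lra.
    by rewrite ler_wpM2r// lerDl.
  have [x0|/ltW x0] := leP 0 x.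
    rewrite !spliceR//.
    apply: le_trans (HN _ _ _ _) _; first by apply/andP; split; lra.
      by apply/andP; split; lra.
    by rewrite ler_wpM2r// lerDr.
  have {}HM : `|g x - g 0| <= M * `|x - 0|.
    by rewrite !spliceL//; apply: HM; apply/andP; split; lra.
  have {}HN : `|g 0 - g y| <= N * `|0 - y|.
    by rewrite !spliceR//; apply: HN; apply/andP; split; lra.
  apply: le_trans (ler_distD (g 0) _ _) _; apply: le_trans (lerD HM HN) _.
  rewrite xyN subr0 sub0r normrN (ler0_norm x0) (ger0_norm y0).
  by rewrite mulrDl; apply: lerD; apply: ler_wpM2l => //; lra.
move=> x y /andP[ax xb] /andP[ay yb].
have [xy|/ltW yx] := leP x y; first exact: H.
by rewrite distrC (distrC x y); exact: H.
Qed.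

Lemma boundary_term_bound al be (f : R -> R) l : exists2 C : R, 0 <= C & forall k c,
  (0 < k)%N -> `|boundary_term al be f (freq b k) c l| <= C / k%:R ^+ l.+1.
Proof.
set G := deriven_on al be l f; set w1 := 2 * pi / b.
have w10 : 0 < w1 by rewrite divr_gt0// mulr_gt0// pi_gt0.
exists ((`|G be| + `|G al|) / w1 ^+ l.+1).
  by rewrite divr_ge0 ?addr_ge0// exprn_ge0// ltW.
move=> k c k0; rewrite /boundary_term normrM normrX normrN1 expr1n mul1r.
apply: le_trans (ler_normB _ _) _.
rewrite -mulrA -invfM -exprMn -freqM mulrDl.
apply: lerD; rewrite normrM; apply: ler_wpM2l => //;
  exact/normr_wave_le/freq_gt0.
Qed.

(** By periodicity of the waves, the boundary terms of order at most [q] of [u]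
    and [v] cancel at 0 and at the identified points [1 - b] and 1; the others
    are small because of the amplitude of their wave. *)
Lemma sum_boundary_terms_bound j : exists2 C : R, 0 <= C & forall k c, (0 < k)%N ->
  `|\sum_(l < j) (boundary_term (1 - b) 0 u (freq b k) c l +
                  boundary_term 0 1 v (freq b k) c l)| <= C / k%:R ^+ q.+2.
Proof.
elim: j => [|j [C C0 HC]].
  by exists 0 => // k c k0; rewrite big_ord0 normr0 mul0r.
have [jq|qj] := leqP j q.
  exists C => // k c k0; rewrite big_ord_recr/=.
  rewrite [X in _ + X](_ : _ = 0) ?addr0; first exact: HC.
  by rewrite /boundary_term match0// match1// wave_period//; ring.
have [D D0 HD] := boundary_term_bound (1 - b) 0 u j.
have [E E0 HE] := boundary_term_bound 0 1 v j.
exists (C + (D + E)) => [|k c k0]; first by rewrite !addr_ge0.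
rewrite big_ord_recr/= mulrDl.
apply: le_trans (ler_normD _ _) _; apply: lerD; first exact: HC.
apply: le_trans (ler_normD _ _) _; apply: le_trans (lerD (HD k c k0) (HE k c k0)) _.
rewrite -mulrDl ler_wpM2l ?addr_ge0// lef_pV2 ?posrE ?exprn_gt0 ?ltr0n//.
by rewrite ler_weXn2l// ler1n.
Qed.

Lemma Rintegral_splice_wave w c :
  \int[mu]_(t in `[1 - b, 1]) (g t * wave w c 0 t) =
  \int[mu]_(t in `[1 - b, 0]) (u t * wave w c 0 t) +
  \int[mu]_(t in `[0, 1]) (v t * wave w c 0 t).
Proof.
rewrite (@Rintegral_segment_split _ _ _ 0); first last.
- by rewrite ltW//=.
- exact/within_continuous_integrable/within_continuous_wave/splice_continuous.
congr (_ + _); apply: eq_Rintegral => x /set_mem/=; rewrite in_itv/= => /andP[x0 x1].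
  by rewrite spliceL.
by rewrite spliceR.
Qed.

Lemma splice_fourier_bound : exists2 K : R, 0 <= K & forall k c, (0 < k)%N ->
  `|\int[mu]_(t in `[1 - b, 1]) (g t * wave (freq b k) c 0 t)| <= K / k%:R ^+ q.+2.
Proof.
have [K K0 HK] := Rintegral_wave_bound b10 ur.
have [K' K'0 HK'] := Rintegral_wave_bound ltr01 vr.
have [C C0 HC] := sum_boundary_terms_bound r.+1.
set w1 := 2 * pi / b.
have w10 : 0 < w1 by rewrite divr_gt0// mulr_gt0// pi_gt0.
exists ((K + K') / w1 ^+ r.+2 + C) => [|k c k0].
  by rewrite addr_ge0// divr_ge0 ?addr_ge0// exprn_ge0// ltW.
have w0 := freq_gt0 hb k0.
rewrite Rintegral_splice_wave.
set I := Rintegral _ _ _; set I' := Rintegral _ _ _.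
have := HK _ c w0; have := HK' _ c w0; have := HC k c k0; rewrite big_split/=.
set S := \sum_(_ < _) _; set S' := \sum_(_ < _) _ => H H1 H2.
have -> : I + I' = (I - S) + (I' - S') + (S + S') by ring.
rewrite mulrDl; apply: le_trans (ler_normD _ _) _; apply: lerD => //.
apply: le_trans (ler_normD _ _) _; apply: le_trans (lerD H2 H1) _.
rewrite -mulrDl -mulrA -invfM ler_wpM2l ?addr_ge0//.
have w1k : 0 < w1 ^+ r.+2 * k%:R ^+ q.+2.
  by apply: mulr_gt0; apply: exprn_gt0; rewrite ?ltr0n.
have wk : 0 < freq b k ^+ r.+2 by apply: exprn_gt0.
rewrite lef_pV2 ?posrE//.
rewrite freqM -/w1 [leRHS]exprMn; apply: ler_wpM2l; first by rewrite exprn_ge0// ltW.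
by rewrite ler_weXn2l// ler1n.
Qed.

End Splice.

(** * Bessel's inequality for bounded measurable functions *)

Section Bessel.
Context {R : realType}.
Notation mu := (@lebesgue_measure R).
Variables a b : R.
Hypothesis ab : a <= b.
Implicit Types (f h : R -> R).

(** The class of integrands used below: it is closed under products, unlike
    integrable functions, and contains the increment of a Lipschitz function
    divided by a sine that vanishes with it, unlike continuous functions. *)
Definition bounded_measurable h : Prop :=
  measurable_fun `[a, b] h /\ exists M, forall t, a <= t <= b -> `|h t| <= M.

Lemma bounded_measurable_integrable h : bounded_measurable h ->
  mu.-integrable `[a, b] (EFin \o h).
Proof.
move=> [mh [M hM]]; apply: measurable_bounded_integrable => //.
  by rewrite [X in (X < _)%E](lebesgue_measure_segment ab) ltry.
exists M; split; first exact: num_real.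
by move=> N MN x xab; apply: le_trans (hM x xab) (ltW MN).
Qed.

Lemma within_continuous_bounded_measurable h : {within `[a, b], continuous h} ->
  bounded_measurable h.
Proof.
move=> ch; split; first exact: subspace_continuous_measurable_fun.
by have [M _ HM] := within_continuous_bounded ch; exists M.
Qed.

Lemma bounded_measurableD f h : bounded_measurable f -> bounded_measurable h ->
  bounded_measurable (fun t => f t + h t).
Proof.
move=> [mf [M fM]] [mh [N hN]]; split; first exact: measurable_funD.
exists (M + N) => t tab; apply: le_trans (ler_normD _ _) _.
by apply: lerD; [exact: fM|exact: hN].
Qed.

Lemma bounded_measurableM f h : bounded_measurable f -> bounded_measurable h ->
  bounded_measurable (fun t => f t * h t).
Proof.
move=> [mf [M fM]] [mh [N hN]]; split; first exact: measurable_funM.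
exists (M * N) => t tab; rewrite normrM.
by apply: ler_pM => //; [exact: fM|exact: hN].
Qed.

Lemma bounded_measurable_cst c : bounded_measurable (fun=> c).
Proof. by split; [exact: measurable_cst|exists `|c|]. Qed.

Variables (phi : nat -> R -> R) (c : R).
Hypotheses (c0 : 0 < c) (phi_bm : forall n, bounded_measurable (phi n)).
Hypothesis phi_orth : forall n m, (n < m)%N ->
  \int[mu]_(t in `[a, b]) (phi n t * phi m t) = 0.
Hypothesis phi_norm : forall n, \int[mu]_(t in `[a, b]) (phi n t * phi n t) = c.

(** [f] is the residual of [h] after subtraction of its first [N] projections:
    its later coefficients are those of [h], and its squared norm has decreased
    by the squares of the coefficients removed, which yields Bessel's
    inequality. *)
Lemma Bessel_residual h N : bounded_measurable h ->
  let coef n := \int[mu]_(t in `[a, b]) (h t * phi n t) in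
  exists2 f, bounded_measurable f &
  (forall m, (N <= m)%N -> \int[mu]_(t in `[a, b]) (f t * phi m t) = coef m) /\
  \int[mu]_(t in `[a, b]) (f t * f t) =
    \int[mu]_(t in `[a, b]) (h t * h t) - c^-1 * \sum_(n < N) coef n ^+ 2.
Proof.
move=> hbm coef; elim: N => [|N [f fbm [fphi ff]]].
  by exists h => //; split=> //; rewrite big_ord0 mulr0 subr0.
pose d := - (c^-1 * coef N).
have dbm n : bounded_measurable (fun t => d * phi n t).
  exact/bounded_measurableM/phi_bm/bounded_measurable_cst.
have ii f1 f2 : bounded_measurable f1 -> bounded_measurable f2 ->
    mu.-integrable `[a, b] (EFin \o (fun t => f1 t * f2 t)).
  by move=> ? ?; exact/bounded_measurable_integrable/bounded_measurableM.
have lin f1 f2 f3 (d1 : R) : bounded_measurable f1 -> bounded_measurable f2 ->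
    bounded_measurable f3 ->
    \int[mu]_(t in `[a, b]) ((f1 t + d1 * f2 t) * f3 t) =
    \int[mu]_(t in `[a, b]) (f1 t * f3 t) +
    d1 * \int[mu]_(t in `[a, b]) (f2 t * f3 t).
  move=> b1 b2 b3.
  rewrite -RintegralZl//; last exact: ii.
  rewrite -RintegralD//; last 2 first.
  - exact: ii.
  - apply: (@bounded_measurable_integrable (fun t => d1 * (f2 t * f3 t))).
    by apply: bounded_measurableM; [exact: bounded_measurable_cst|exact: bounded_measurableM].
  by apply: eq_Rintegral => t _; ring.
have fbm' : bounded_measurable (fun t => f t + d * phi N t).
  exact: bounded_measurableD.
exists (fun t => f t + d * phi N t) => //; split=> [m Nm|].
  by rewrite lin// phi_orth// mulr0 addr0 fphi// ltnW.
have comm f1 f2 : \int[mu]_(t in `[a, b]) (f1 t * f2 t) =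
    \int[mu]_(t in `[a, b]) (f2 t * f1 t).
  by apply: eq_Rintegral => t _; rewrite mulrC.
rewrite lin// (comm f) (comm (phi N)) !lin// (comm (phi N) f) ff fphi//.
rewrite phi_norm big_ord_recr/= /d.
by field; rewrite gt_eqF.
Qed.

Lemma Bessel_cvg0 h : bounded_measurable h ->
  (fun n => \int[mu]_(t in `[a, b]) (h t * phi n t)) @ \oo --> (0 : R).
Proof.
move=> hbm; set coef := fun n => _.
pose A := c * \int[mu]_(t in `[a, b]) (h t * h t).
have bnd N : \sum_(n < N) coef n ^+ 2 <= A.
  have [f _ [_ ff]] := Bessel_residual N hbm.
  have : 0 <= \int[mu]_(t in `[a, b]) (f t * f t).
    by apply: Rintegral_ge0 => t _; rewrite -expr2 sqr_ge0.
  by rewrite ff subr_ge0 ler_pdivrMl.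
have cv : cvgn (series (fun n => coef n ^+ 2)).
  apply: nondecreasing_is_cvgn.
    by apply: nondecreasing_series => n _ _; rewrite sqr_ge0.
  by exists A => _ [n _ <-]; rewrite /series/= big_mkord.
have := cvg_series_cvg_0 cv => c20.
apply/cvgrPdist_lt => e e0.
have e20 : 0 < e ^+ 2 by rewrite exprn_gt0.
have /cvgrPdist_lt/(_ _ e20) := c20; apply: filterS => n.
rewrite !sub0r !normrN normrX ltr_pXn2r// ?nnegrE// ltW//.
Qed.

End Bessel.

(** * Pointwise convergence of Fourier series of periodic Lipschitz functions *)

Section SineBound.
Context {R : realType}.
Implicit Types y : R.

Let kappa : R := cos 1 ^+ 2.

(** With z = y / 2 <= 1, sin y = 2 sin z cos z, where cos z >= cos 1 and, by the
    mean value theorem, sin z >= z cos 1. *)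
Lemma sin_ge_linear y : 0 <= y <= pi / 2 -> kappa * y <= sin y.
Proof.
move=> /andP[y0 ypi]; pose z := y / 2.
have z0 : 0 <= z by rewrite divr_ge0.
have z1 : z <= 1.
  have /andP[_ p2] := @pihalf_02 R; rewrite /z ler_pdivrMr// mul1r.
  by rewrite (le_trans ypi)// ltW.
have c10 : 0 < cos 1 :> R := cos1_gt0 R.
have pi1 : 1 <= pi :> R by rewrite (le_trans _ (pi_ge2 R))// ler1n.
have cge (x : R) : 0 <= x <= 1 -> cos 1 <= cos x.
  move=> /andP[x0 x1]; have [->//|x1'] := eqVneq x 1.
  have x0pi : x \in `[0, pi] by rewrite in_itv/= x0 (le_trans x1).
  have o0pi : 1 \in `[0, pi : R] by rewrite in_itv/= ler01.
  by rewrite ltW// ltr_cos// lt_neqAle x1' x1.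
have dsin y' : y' \in `]0, z[ -> is_derive y' 1 (@sin R) (cos y').
  by move=> _; exact: is_derive_sin.
have csin : {within `[0, z], continuous (@sin R)}.
  exact/continuous_subspaceT/continuous_sin.
have [xi xz sE] := MVT_segment z0 dsin csin.
have zle : cos 1 * z <= sin z.
  move: sE; rewrite sin0 !subr0 => ->; rewrite ler_wpM2r// cge//.
  by move: xz; rewrite in_itv/= => /andP[-> /le_trans->].
have -> : sin y = (cos z * sin z) *+ 2 by rewrite -sin_mulr2n; congr sin; rewrite /z; field.
have -> : kappa * y = (cos 1 * (cos 1 * z)) *+ 2.
  by rewrite /kappa /z; field.
rewrite lerMn2r/=; apply: ler_pM => //; first exact: ltW.
  by rewrite mulr_ge0// ltW.
by rewrite cge// z0.
Qed.

(** The minimum is the distance of [d] to the lattice b Z, along which the sine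
    vanishes; the symmetry of the sine about [pi / 2] handles the far half. *)
Lemma norm_sin_ge_linear (b d : R) : 0 < b -> `|d| <= b ->
  kappa * (pi / b * Num.min `|d| (b - `|d|)) <= `|sin (pi * d / b)|.
Proof.
move=> b0 db; set y := pi / b * `|d|.
have pb : 0 < pi / b by rewrite divr_gt0// pi_gt0.
have y0 : 0 <= y by rewrite mulr_ge0// ltW.
have ypi : y <= pi.
  by rewrite /y mulrAC ler_pdivrMr// ler_wpM2l// pi_ge0.
have -> : `|sin (pi * d / b)| = sin y.
  have sy : 0 <= sin y by rewrite sin_ge0_pi// y0.
  rewrite -[RHS]ger0_norm// /y mulrAC.
  have [d0|d0] := leP 0 d; first by rewrite (ger0_norm d0).
  by rewrite (ltr0_norm d0) mulrN sinN normrN.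
have [yh|yh] := leP y (pi / 2).
  apply: le_trans (sin_ge_linear _); last by rewrite y0.
  by rewrite ler_wpM2l ?sqr_ge0// /y ler_wpM2l ?ge_min ?lexx// ltW.
have -> : sin y = sin (pi - y) by rewrite sinB sinpi cospi; ring.
have piyE : pi - y = pi / b * (b - `|d|) by rewrite /y; field; rewrite gt_eqF.
apply: le_trans (sin_ge_linear _); last by apply/andP; split; lra.
by rewrite ler_wpM2l ?sqr_ge0// piyE ler_wpM2l ?ge_min ?lexx ?orbT// ltW.
Qed.

End SineBound.

Section Dirichlet.
Context {R : realType}.
Notation mu := (@lebesgue_measure R).
Variables (b : R) (g : R -> R) (M x : R).
Hypotheses (hb : 1 < b) (cg : {within `[1 - b, 1], continuous g}).
Hypotheses (M0 : 0 <= M) (gL : forall t s, 1 - b <= t <= 1 -> 1 - b <= s <= 1 ->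
  `|g t - g s| <= M * `|t - s|).
Hypotheses (gp : g (1 - b) = g 1) (x01 : 1 - b <= x <= 1).

Let b0 : 0 < b. Proof. exact: lt_trans hb. Qed.
Let ab : 1 - b <= 1. Proof. by rewrite gerBl ltW. Qed.

Lemma measurable_invr : measurable_fun [set: R] (@GRing.inv R).
Proof.
rewrite -(setvU [set 0]); apply/measurable_funU => //; first exact: measurableC.
split; last exact: measurable_fun_set1.
apply: open_continuous_measurable_fun; first by apply: closed_openC; rewrite -set_itv1; exact: itv_closed.
by move=> y /set_mem/= /eqP y0; exact: inv_continuous.
Qed.

(** The sine vanishes not only at [t = x], but also when [x] and [t] are
    opposite end points, and there the periodicity of [g] takes over: if [t] is
    more than half a period away from [x], the increment of [g] is estimated by
    going around through the identified end points. *)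
Lemma increment_le_sin : exists2 C : R, 0 <= C & forall t, 1 - b <= t <= 1 ->
  `|g t - g x| <= C * `|sin (pi * (x - t) / b)|.
Proof.
have kap : 0 < cos 1 ^+ 2 * (pi / b) :> R.
  by rewrite mulr_gt0// ?divr_gt0// ?pi_gt0// exprn_gt0// cos1_gt0.
exists (M / (cos 1 ^+ 2 * (pi / b))); first by rewrite divr_ge0// ltW.
move=> t tab; case/andP: (x01) => x1 x2; case/andP: (tab) => t1 t2.
have xt : `|x - t| <= b by rewrite ler_norml; apply/andP; split; lra.
apply: (@le_trans _ _ (M * Num.min `|x - t| (b - `|x - t|))); last first.
  rewrite -mulrA; apply: ler_wpM2l => //.
  by rewrite ler_pdivlMl//; apply: le_trans (norm_sin_ge_linear b0 xt); rewrite [leRHS]mulrA.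
rewrite minr_pMr// le_min; apply/andP; split.
  by rewrite (distrC x); exact: gL.
have e1 : 1 - b <= (1 : R) <= 1 by rewrite ab lexx.
have e2 : 1 - b <= 1 - b <= 1 by rewrite ab lexx.
have [tx|xt'] := leP t x.
  have H : `|g t - g (1 - b)| + `|g 1 - g x| <= M * (b - `|x - t|).
    apply: le_trans (lerD (gL tab e2) (gL e1 x01)) _.
    rewrite -mulrDr ler_wpM2l// !ger0_norm; lra.
  by apply: le_trans H; rewrite -gp; exact: ler_distD.
have H : `|g t - g 1| + `|g (1 - b) - g x| <= M * (b - `|x - t|).
  apply: le_trans (lerD (gL tab e1) (gL e2 x01)) _.
  rewrite -mulrDr ler_wpM2l//.
  rewrite (ler0_norm (x := t - 1)) ?(ler0_norm (x := 1 - b - x)) ?(ler0_norm (x := x - t)); lra.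
by apply: le_trans H; rewrite gp; exact: ler_distD.
Qed.

Definition harmonic_integral k : R :=
  \int[mu]_(t in `[1 - b, 1]) (g t * wave (freq b k) (freq b k * x) 0 t).

Definition partial_sum n : R :=
  b^-1 * (\int[mu]_(t in `[1 - b, 1]) g t + \sum_(k < n) 2 * harmonic_integral k.+1).

(** The numerator of the Dirichlet kernel, whose denominator is
    sin (pi (x - t) / b). *)
Definition half_odd_sine n t : R := sin ((2 * n + 1)%N%:R * (pi * (x - t) / b)).

Let odd_natr n : (2 * n + 1)%N%:R = 2 * n%:R + 1 :> R.
Proof. by rewrite natrD natrM. Qed.

Lemma wave_cos k t :
  wave (freq b k) (freq b k * x) 0 t = cos ((2 * k)%N%:R * (pi * (x - t) / b)).
Proof.
rewrite /wave expr0 divr1 mul0r subr0 -cosN natrM; congr cos.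
by rewrite /freq; field; rewrite gt_eqF.
Qed.

Lemma wave_bm k : bounded_measurable (1 - b) 1 (wave (freq b k) (freq b k * x) 0).
Proof.
apply: within_continuous_bounded_measurable.
exact/continuous_subspaceT/continuous_wave.
Qed.

Lemma half_odd_sine_bm n : bounded_measurable (1 - b) 1 (half_odd_sine n).
Proof.
apply: within_continuous_bounded_measurable; apply: continuous_subspaceT => t.
apply: continuous_comp; last exact: continuous_sin.
apply: cvgM; first exact: cvg_cst.
apply: cvgM; last exact: cvg_cst.
by apply: cvgM; [exact: cvg_cst|apply: cvgB; [exact: cvg_cst|exact: cvg_id]].
Qed.

(** A product of two half-integer waves is a combination of waves of integer
    frequency, whose integrals over a period vanish. *)
Lemma half_odd_sine_orth n m : (n < m)%N ->
  \int[mu]_(t in `[1 - b, 1]) (half_odd_sine n t * half_odd_sine m t) = 0.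
Proof.
move=> nm; have mn0 : (0 < m - n)%N by rewrite subn_gt0.
have mn1 : (0 < m + n + 1)%N by rewrite addn1.
pose W k := wave (freq b k) (freq b k * x) 0.
have iW k c : mu.-integrable `[1 - b, 1] (EFin \o (fun t => c * W k t)).
  apply/(bounded_measurable_integrable ab)/bounded_measurableM/wave_bm.
  exact: bounded_measurable_cst.
have iW1 k : mu.-integrable `[1 - b, 1] (EFin \o W k).
  exact/(bounded_measurable_integrable ab)/wave_bm.
transitivity (\int[mu]_(t in `[1 - b, 1])
    (2^-1 * W (m - n)%N t - 2^-1 * W (m + n + 1)%N t)).
  apply: eq_Rintegral => t _; rewrite /W !wave_cos /half_odd_sine.
  set th := pi * (x - t) / b; set A := (2 * n + 1)%N%:R * th; set B := (2 * m + 1)%N%:R * th.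
  have -> : (2 * (m - n))%N%:R * th = B - A.
    by rewrite natrM natrB ?(ltnW nm)// /A /B !odd_natr; ring.
  have -> : (2 * (m + n + 1))%N%:R * th = B + A.
    by rewrite natrM (natrD _ (m + n)) (natrD _ m) /A /B !odd_natr; ring.
  by rewrite cosB cosD; field.
rewrite RintegralB// !RintegralZl// !Rintegral_wave0//.
by rewrite mulr0 subr0.
Qed.

Lemma half_odd_sine_norm n :
  \int[mu]_(t in `[1 - b, 1]) (half_odd_sine n t * half_odd_sine n t) = b / 2.
Proof.
pose W k := wave (freq b k) (freq b k * x) 0.
have iW k c : mu.-integrable `[1 - b, 1] (EFin \o (fun t => c * W k t)).
  apply/(bounded_measurable_integrable ab)/bounded_measurableM/wave_bm.
  exact: bounded_measurable_cst.
have iW1 k : mu.-integrable `[1 - b, 1] (EFin \o W k).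
  exact/(bounded_measurable_integrable ab)/wave_bm.
have ic (c : R) : mu.-integrable `[1 - b, 1] (EFin \o (fun=> c)).
  exact/(bounded_measurable_integrable ab)/bounded_measurable_cst.
transitivity (\int[mu]_(t in `[1 - b, 1]) (2^-1 - 2^-1 * W (2 * n + 1)%N t)).
  apply: eq_Rintegral => t _; rewrite /W !wave_cos /half_odd_sine.
  set th := pi * (x - t) / b; set A := (2 * n + 1)%N%:R * th.
  have -> : (2 * (2 * n + 1))%N%:R * th = A *+ 2 by rewrite natrM /A; ring.
  by rewrite cos_mulr2n -expr2 sin2cos2; field.
rewrite RintegralB// RintegralZl// Rintegral_wave0 ?addn1// mulr0 subr0.
rewrite Rintegral_cst//.
transitivity (2^-1 * fine (1 - (1 - b))%:E); last by rewrite /=; ring.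
by congr (_ * fine _); rewrite -lebesgue_measure_segment.
Qed.

Let incr t := g t - g x.
Let quot t := incr t / sin (pi * (x - t) / b).

(** Division by 0 yields 0, which is harmless where the sine vanishes since the
    increment then vanishes too. *)
Lemma incrE t : 1 - b <= t <= 1 -> incr t = quot t * sin (pi * (x - t) / b).
Proof.
move=> tab; rewrite /quot; set s := sin _.
have [s0|s0] := eqVneq s 0; last by rewrite divfK.
have [C _ /(_ t tab)] := increment_le_sin.
by rewrite -/s s0 normr0 mulr0 normr_le0 mulr0 => /eqP.
Qed.

Lemma sin_continuous_arg : continuous (fun t : R => sin (pi * (x - t) / b)).
Proof.
move=> t; apply: continuous_comp; last exact: continuous_sin.
apply: cvgM; last exact: cvg_cst.
by apply: cvgM; [exact: cvg_cst|apply: cvgB; [exact: cvg_cst|exact: cvg_id]].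
Qed.

Lemma incr_bm : bounded_measurable (1 - b) 1 incr.
Proof.
apply: bounded_measurableD; last exact: bounded_measurable_cst.
exact: within_continuous_bounded_measurable.
Qed.

Lemma quot_bm : bounded_measurable (1 - b) 1 quot.
Proof.
split.
  apply: measurable_funM; first by case: incr_bm.
  apply: (measurableT_comp measurable_invr).
  apply: measurable_funTS; apply: continuous_measurable_fun.
  exact: sin_continuous_arg.
have [C C0 HC] := increment_le_sin; exists C => t tab.
rewrite /quot; set s := sin _; rewrite normrM normfV.
have [s0|s0] := eqVneq s 0; first by rewrite s0 normr0 invr0 mulr0.
by rewrite ler_pdivrMr ?normr_gt0//; exact: HC.
Qed.

(** Dirichlet's formula, obtained by induction on [n] from
    sin (y + th) = sin (y - th) + 2 cos y sin th. *)
Lemma partial_sum_error n : partial_sum n - g x =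
  b^-1 * \int[mu]_(t in `[1 - b, 1]) (quot t * half_odd_sine n t).
Proof.
pose W k := wave (freq b k) (freq b k * x) 0.
have ig := within_continuous_integrable cg.
have iW k : mu.-integrable `[1 - b, 1] (EFin \o W k).
  exact/(bounded_measurable_integrable ab)/wave_bm.
have ic (c : R) : mu.-integrable `[1 - b, 1] (EFin \o (fun=> c)).
  exact/(bounded_measurable_integrable ab)/bounded_measurable_cst.
have igW k : mu.-integrable `[1 - b, 1] (EFin \o (fun t => g t * W k t)).
  apply/(bounded_measurable_integrable ab)/bounded_measurableM/wave_bm.
  exact: within_continuous_bounded_measurable.
have icW (c : R) k : mu.-integrable `[1 - b, 1] (EFin \o (fun t => c * W k t)).
  apply/(bounded_measurable_integrable ab)/bounded_measurableM/wave_bm.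
  exact: bounded_measurable_cst.
have iqs m : mu.-integrable `[1 - b, 1] (EFin \o (fun t => quot t * half_odd_sine m t)).
  apply/(bounded_measurable_integrable ab)/bounded_measurableM/half_odd_sine_bm.
  exact: quot_bm.
have iiW (c : R) k : mu.-integrable `[1 - b, 1] (EFin \o (fun t => c * (incr t * W k t))).
  apply/(bounded_measurable_integrable ab)/bounded_measurableM.
    exact: bounded_measurable_cst.
  exact/bounded_measurableM/wave_bm/incr_bm.
have iiW1 k : mu.-integrable `[1 - b, 1] (EFin \o (fun t => incr t * W k t)).
  apply/(bounded_measurable_integrable ab)/bounded_measurableM/wave_bm.
  exact: incr_bm.
rewrite /partial_sum -[X in _ - X](mulKf (lt0r_neq0 b0)) -mulrBr; congr (_ * _).
elim: n => [|n ih].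
  rewrite big_ord0 addr0.
  have -> : b * g x = \int[mu]_(t in `[1 - b, 1]) g x.
    rewrite Rintegral_cst//.
    transitivity (g x * fine (1 - (1 - b))%:E); first by rewrite /=; ring.
    by congr (_ * fine _); rewrite -lebesgue_measure_segment.
  rewrite -RintegralB//; apply: eq_Rintegral => t /set_mem/= tab.
  rewrite in_itv/= in tab.
  by rewrite /half_odd_sine muln0 add0n mul1r -incrE.
rewrite big_ord_recr/= addrA [LHS]addrAC ih.
have -> : harmonic_integral n.+1 =
    \int[mu]_(t in `[1 - b, 1]) (incr t * W n.+1 t).
  have W0 : \int[mu]_(t in `[1 - b, 1]) W n.+1 t = 0 by exact: Rintegral_wave0.
  transitivity (\int[mu]_(t in `[1 - b, 1]) (g t * W n.+1 t) -
      \int[mu]_(t in `[1 - b, 1]) (g x * W n.+1 t)).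
    by rewrite RintegralZl// W0 mulr0 subr0.
  rewrite -RintegralB//; apply: eq_Rintegral => t _.
  by rewrite /incr /W; ring.
rewrite -RintegralZl// -RintegralD//; apply: eq_Rintegral => t /set_mem/= tab.
rewrite in_itv/= in tab.
rewrite incrE// /W wave_cos /half_odd_sine.
set th := pi * (x - t) / b; set A := (2 * n.+1)%N%:R * th.
have -> : (2 * n + 1)%N%:R * th = A - th.
  by rewrite /A odd_natr natrM -(natr1 n); ring.
have -> : (2 * n.+1 + 1)%N%:R * th = A + th by rewrite /A odd_natr natrM; ring.
by rewrite sinB sinD; ring.
Qed.

(** The error is a coefficient of the bounded function [quot] with respect to
    the orthogonal half-integer sines, hence tends to 0 by Bessel's
    inequality. *)
Lemma partial_sum_cvg : partial_sum n @[n --> \oo] --> g x.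
Proof.
apply/subr_cvg0.
have -> : (fun n => partial_sum n - g x) = (fun n =>
    b^-1 * \int[mu]_(t in `[1 - b, 1]) (quot t * half_odd_sine n t)).
  by apply/funext => n; rewrite partial_sum_error.
rewrite -[X in _ --> X](mulr0 b^-1).
apply: (@cvgM _ _ _ _ (fun=> b^-1)); first exact: cvg_cst.
apply: (@Bessel_cvg0 _ _ _ ab half_odd_sine (b / 2)).
- by rewrite divr_gt0.
- exact: half_odd_sine_bm.
- exact: half_odd_sine_orth.
- exact: half_odd_sine_norm.
- exact: quot_bm.
Qed.

End Dirichlet.

(** * Rate of convergence from the decay of the Fourier coefficients *)

Section Tails.
Context {R : realType}.

(** With x = 1 / N and y = 1 / (N + 1), x - y = x y dominates y ^ 2. *)
Lemma invr_exp_telescope (N q : nat) : (0 < N)%N ->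
  N.+1%:R ^- q.+2 <= N%:R ^- q.+1 - N.+1%:R ^- q.+1 :> R.
Proof.
move=> N0; rewrite -!exprVn; set x := N%:R^-1; set y := N.+1%:R^-1.
have Nr : 0 < N%:R :> R by rewrite ltr0n.
have y0 : 0 <= y by rewrite invr_ge0.
have yx : y <= x by rewrite lef_pV2 ?posrE ?ltr0n// ler_nat.
have xy : x - y = x * y.
  rewrite /x /y -natr1; field.
  by rewrite gt_eqF//= gt_eqF// ltr_wpDr.
have yqxq : y ^+ q <= x ^+ q by rewrite lerXn2r ?nnegrE// (le_trans y0).
have x0 : 0 <= x := le_trans y0 yx.
have xq0 : 0 <= x ^+ q by exact: exprn_ge0.
apply: (@le_trans _ _ (x ^+ q * (x - y))).
  rewrite xy exprSr exprSr -mulrA; apply: ler_pM => //.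
  - exact: exprn_ge0.
  - exact: mulr_ge0.
  - exact: ler_wpM2r.
by rewrite mulrBr !exprSr lerB// ler_wpM2r.
Qed.

Lemma sum_tail_bound (h : nat -> R) (K : R) (q n m : nat) : 0 <= K ->
  (forall k, (0 < k)%N -> `|h k| <= K / k%:R ^+ q.+2) ->
  (0 < n)%N -> (n <= m)%N ->
  `|\sum_(k < m) h k.+1 - \sum_(k < n) h k.+1| <= K / n%:R ^+ q.+1.
Proof.
move=> K0 hK n0 nm.
suff H : `|\sum_(k < m) h k.+1 - \sum_(k < n) h k.+1| <=
    K * (n%:R ^- q.+1 - m%:R ^- q.+1).
  apply: le_trans H _; apply: ler_wpM2l => //.
  by rewrite gerBl invr_ge0 exprn_ge0.
rewrite -(subnKC nm); elim: (m - n)%N => [|d ih].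
  by rewrite addn0 !subrr normr0 mulr0.
rewrite addnS big_ord_recr/= addrAC; apply: le_trans (ler_normD _ _) _.
apply: le_trans (lerD ih (hK _ (ltn0Sn _))) _.
rewrite -mulrDr; apply: ler_wpM2l => //.
have := @invr_exp_telescope (n + d) q (ltn_addr d n0); lra.
Qed.

End Tails.

Section SpliceRate.
Context {R : realType}.
Variables (b : R) (r q : nat) (u v : R -> R).
Hypotheses (hb : 1 < b) (r1 : (1 <= r)%N) (qr : (q <= r)%N).
Hypotheses (ur : Dr1 r (1 - b) 0 u) (vr : Dr1 r 0 1 v).
Hypothesis match0 : forall l, (l <= q)%N ->
  deriven_on (1 - b) 0 l u 0 = deriven_on 0 1 l v 0.
Hypothesis match1 : forall l, (l <= q)%N ->
  deriven_on (1 - b) 0 l u (1 - b) = deriven_on 0 1 l v 1.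

(** The series converges to the spliced function, so the error is the tail of
    the series, whose terms are O(1 / k ^ (q + 2)). *)
Lemma splice_partial_sum_rate : exists2 C : R, 0 <= C & forall n (x : R),
  (0 < n)%N -> 0 <= x <= 1 ->
  `|partial_sum b (splice u v) x n - v x| <= C / n%:R ^+ q.+1.
Proof.
have [K K0 HK] := splice_fourier_bound hb qr ur vr match0 match1.
have [M M0 HM] := splice_lipschitz r1 ur vr match0.
have cg := splice_continuous hb ur vr match0.
have gp := splice_period hb match0 match1.
have b0 : 0 < b := lt_trans ltr01 hb.
exists (b^-1 * (2 * K)) => [|n x n0 /andP[x0 x1]].
  by rewrite mulr_ge0 ?invr_ge0 ?mulr_ge0// ltW.
have xb : 1 - b <= x <= 1 by have := hb; rewrite x1 andbT => ?; lra.
have cvgS := partial_sum_cvg hb cg M0 HM gp xb.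
rewrite -(spliceR u v x0).
apply/ler_addgt0Pr => e e0.
have /cvgrPdist_lt/(_ _ e0)[N _ HN] := cvgS.
pose m := maxn n N.
have mE : `|splice u v x - partial_sum b (splice u v) x m| < e by apply: HN; exact: leq_maxr.
have nm : `|partial_sum b (splice u v) x m - partial_sum b (splice u v) x n| <=
    b^-1 * (2 * K) / n%:R ^+ q.+1.
  rewrite /partial_sum -mulrBr opprD addrACA subrr add0r normrM gtr0_norm ?invr_gt0//.
  rewrite -mulrA ler_wpM2l ?invr_ge0 ?(ltW b0)//.
  apply: (@sum_tail_bound _ (fun k => 2 * harmonic_integral b (splice u v) x k)) => //.
  - by rewrite mulr_ge0.
  - move=> k k0; rewrite normrM ger0_norm// -mulrA ler_wpM2l//.
    exact: HK.
  - exact: leq_maxl.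
rewrite distrC; apply: le_trans (ler_distD (partial_sum b (splice u v) x m) _ _) _.
by rewrite addrC; apply: lerD => //; exact: ltW.
Qed.

End SpliceRate.

(** * The truncated Fourier series in real form *)

Section RealForm.
Context {R : realType}.
Notation mu := (@lebesgue_measure R).
Variables (b : R) (g : R -> R) (x : R).
Hypotheses (hb : 1 < b) (cg : {within `[1 - b, 1], continuous g}).

Let term (k : int) : R[i] :=
  fourier_coef b g k * expi (2 * pi * k%:~R * x / b).
Let cosI w := \int[mu]_(t in `[1 - b, 1]) (g t * cos (w * t)).
Let sinI w := \int[mu]_(t in `[1 - b, 1]) (g t * sin (w * t)).

Lemma fourier_termE k (w := 2 * pi * k%:~R / b) :
  term k = (b^-1 * (cosI w * cos (w * x) + sinI w * sin (w * x))) +i*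
           (b^-1 * (cosI w * sin (w * x) - sinI w * cos (w * x))).
Proof.
have E t : 2 * pi * k%:~R * t / b = w * t by rewrite /w mulrAC.
rewrite /term /fourier_coef /cintegral E.
have -> : \int[mu]_(t in `[1 - b, 1])
    complex.Re ((g t)%:C * expi (- (2 * pi * k%:~R * t / b))) = cosI w.
  by apply: eq_Rintegral => t _; rewrite E /= mul0r subr0 cosN.
have -> : \int[mu]_(t in `[1 - b, 1])
    complex.Im ((g t)%:C * expi (- (2 * pi * k%:~R * t / b))) = - sinI w.
  transitivity (\int[mu]_(t in `[1 - b, 1]) (-1 * (g t * sin (w * t)))).
    by apply: eq_Rintegral => t _; rewrite E /= mul0r addr0 sinN mulN1r mulrN.
  rewrite RintegralZl ?mulN1r//.
  apply: within_continuous_integrable => t; apply: cvgM; first exact: cg.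
  apply: (@continuous_subspaceT _ _ _ (fun t => sin (w * t))) => y.
  by apply: continuous_comp; [apply: cvgM; [exact: cvg_cst|exact: cvg_id]|exact: continuous_sin].
by apply/eqP; rewrite eq_complex /=; apply/andP; split; apply/eqP; ring.
Qed.

(** The frequencies [k] and [- k] are conjugate, and their sum is the projection
    of [g] on a single real wave with phase determined by [x]. *)
Lemma fourier_term_pair (k : nat) :
  term k + term (- k%:Z) = (b^-1 * (2 * harmonic_integral b g x k))%:C.
Proof.
rewrite !fourier_termE.
set w := 2 * pi * (k : int)%:~R / b.
have -> : 2 * pi * (- k%:Z)%:~R / b = - w by rewrite mulrNz mulrN mulNr.
have -> : cosI (- w) = cosI w.
  by apply: eq_Rintegral => t _; rewrite mulNr cosN.
have cC : {within `[1 - b, 1], continuous (fun t => g t * cos (w * t))}.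
  move=> t; apply: cvgM; first exact: cg.
  apply: (@continuous_subspaceT _ _ _ (fun t => cos (w * t))) => y.
  by apply: continuous_comp; [apply: cvgM; [exact: cvg_cst|exact: cvg_id]|exact: continuous_cos].
have cS : {within `[1 - b, 1], continuous (fun t => g t * sin (w * t))}.
  move=> t; apply: cvgM; first exact: cg.
  apply: (@continuous_subspaceT _ _ _ (fun t => sin (w * t))) => y.
  by apply: continuous_comp; [apply: cvgM; [exact: cvg_cst|exact: cvg_id]|exact: continuous_sin].
have iC := within_continuous_integrable cC.
have iS := within_continuous_integrable cS.
have iM (h : R -> R) c : {within `[1 - b, 1], continuous h} ->
    mu.-integrable `[1 - b, 1] (EFin \o (fun t => h t * c)).
  move=> ch; apply: within_continuous_integrable => t.
  by apply: cvgM; [exact: ch|exact: cvg_cst].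
have -> : sinI (- w) = - sinI w.
  transitivity (\int[mu]_(t in `[1 - b, 1]) (-1 * (g t * sin (w * t)))).
    by apply: eq_Rintegral => t _; rewrite (mulNr w) sinN mulrN mulN1r.
  by rewrite RintegralZl ?mulN1r.
have -> : harmonic_integral b g x k = cosI w * cos (w * x) + sinI w * sin (w * x).
  rewrite -!RintegralZr// -RintegralD//; last 2 first.
  - exact: iM.
  - exact: iM.
  apply: eq_Rintegral => t _.
  rewrite /wave expr0 divr1 mul0r subr0 cosB /w /freq; ring.
rewrite mulNr cosN sinN.
by apply/eqP; rewrite eq_complex /=; apply/andP; split; apply/eqP; ring.
Qed.

Lemma fourier_truncE n : fourier_trunc n b g x = (partial_sum b g x n)%:C.
Proof.
transitivity (\sum_(i < n.*2.+1) term (i%:Z - n%:Z)); first by [].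
rewrite /partial_sum mulrDr mulr_sumr.
elim: n => [|n ih].
  rewrite big_ord_recl !big_ord0 !addr0 [LHS](fourier_termE 0).
  rewrite mulr0z !mulr0 mul0r !mul0r cos0 sin0.
  have -> : sinI 0 = 0.
    transitivity (\int[mu]_(t in `[1 - b, 1]) (0 : R)).
      by apply: eq_Rintegral => t _; rewrite mul0r sin0 mulr0.
    by rewrite Rintegral_cst// mul0r.
  have -> : cosI 0 = \int[mu]_(t in `[1 - b, 1]) g t.
    by apply: eq_Rintegral => t _; rewrite mul0r cos0 mulr1.
  by apply/eqP; rewrite eq_complex /=; apply/andP; split; apply/eqP; ring.
rewrite doubleS big_ord_recl big_ord_recr/= [in RHS]big_ord_recr/=.
have -> : \sum_(i < n.*2.+1) term ((bump 0 i)%:Z - n.+1%:Z) =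
    \sum_(i < n.*2.+1) term (i%:Z - n%:Z).
  by apply: eq_bigr => i _; congr term; rewrite /bump/=; lia.
rewrite ih.
have -> : (0%N)%:Z - n.+1%:Z = - n.+1%:Z by lia.
have -> : (bump 0 n.*2.+1)%:Z - n.+1%:Z = n.+1%:Z by rewrite /bump/=; lia.
rewrite addrCA (addrC (term (- _))) fourier_term_pair.
by apply/eqP; rewrite eq_complex /= addr0 addrA !eqxx.
Qed.

End RealForm.

(** * Approximate boundary data *)

Section Linearity.
Context {R : realType}.
Notation mu := (@lebesgue_measure R).
Variables (b : R) (g g1 g2 : R -> R) (c : R).
Hypotheses (hb : 1 < b) (cg1 : {within `[1 - b, 1], continuous g1}).
Hypothesis cg2 : {within `[1 - b, 1], continuous g2}.
Hypothesis gE : {in `[1 - b, 1], forall t, g t = c * g1 t + g2 t}.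

Lemma partial_sum_comb x n :
  partial_sum b g x n = c * partial_sum b g1 x n + partial_sum b g2 x n.
Proof.
have comb (h : R -> R) : {within `[1 - b, 1], continuous h} ->
    \int[mu]_(t in `[1 - b, 1]) (g t * h t) =
    c * \int[mu]_(t in `[1 - b, 1]) (g1 t * h t) +
    \int[mu]_(t in `[1 - b, 1]) (g2 t * h t).
  move=> ch.
  have c1 : {within `[1 - b, 1], continuous (fun t => g1 t * h t)}.
    by move=> t; apply: cvgM; [exact: cg1|exact: ch].
  have c2 : {within `[1 - b, 1], continuous (fun t => g2 t * h t)}.
    by move=> t; apply: cvgM; [exact: cg2|exact: ch].
  have c3 : {within `[1 - b, 1], continuous (fun t => c * (g1 t * h t))}.
    by move=> t; apply: cvgM; [exact: cvg_cst|exact: c1].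
  have i1 := within_continuous_integrable c1.
  have i2 := within_continuous_integrable c2.
  have i3 := within_continuous_integrable c3.
  rewrite -RintegralZl// -RintegralD//; apply: eq_Rintegral => t /set_mem/= tab.
  by rewrite gE//; ring.
have harm k : harmonic_integral b g x k =
    c * harmonic_integral b g1 x k + harmonic_integral b g2 x k.
  by apply: comb; exact/continuous_subspaceT/continuous_wave.
have I0 : \int[mu]_(t in `[1 - b, 1]) g t =
    c * \int[mu]_(t in `[1 - b, 1]) g1 t + \int[mu]_(t in `[1 - b, 1]) g2 t.
  have one (h : R -> R) :
      \int[mu]_(t in `[1 - b, 1]) h t = \int[mu]_(t in `[1 - b, 1]) (h t * 1).
    by apply: eq_Rintegral => t _; rewrite mulr1.
  by rewrite (one g) (one g1) (one g2); apply: (comb (fun=> 1)) => t; exact: cvg_cst.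
rewrite /partial_sum I0.
rewrite (eq_bigr (fun k : 'I_n => c * (2 * harmonic_integral b g1 x k.+1) +
  2 * harmonic_integral b g2 x k.+1)); last by move=> k _; rewrite harm; ring.
by rewrite big_split/= -mulr_sumr; ring.
Qed.

End Linearity.

(** Since [L] is linear, an error in the boundary data is a combination of errors
    in single entries, and the entry in column [k] only affects derivatives of
    order at least [k] at the junctions. *)
Section ContinuationError.
Context {R : realType}.
Variables (r s : nat) (b : R) (f : R -> R) (L : 'M[R]_(2, r.+1) -> R -> R).
Hypotheses (hr : (1 <= r)%N) (hs : (s < r)%N) (hb : 1 < b).
Hypotheses (hf : Dr1 r 0 1 f) (hL : continuation_operator b L).

Let F := boundary_data r f.
(* The continuation of an entry of the error is extended to [0, 1] by 0, as both
   continuations agree with f there. *)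
Let null : R -> R := fun=> 0.
Let agree (A : 'M[R]_(2, r.+1)) : Prop :=
  forall (j : 'I_2) (k : 'I_r.+1), (k <= s)%N -> A j k = F j k.

Let b10 : 1 - b < 0. Proof. by rewrite subr_lt0. Qed.

Lemma boundary_data0 l (lr : (l < r.+1)%N) :
  F 0 (Ordinal lr) = deriven_on 0 1 l f 0.
Proof. by rewrite mxE. Qed.

Lemma boundary_data1 l (lr : (l < r.+1)%N) :
  F 1 (Ordinal lr) = deriven_on 0 1 l f 1.
Proof. by rewrite mxE. Qed.

Lemma deriven_on_null l (x : R) : 0 <= x <= 1 -> deriven_on 0 1 l null x = 0.
Proof. by move=> x01; apply: (deriven_on_eq0 l ltr01) => //; rewrite in_itv. Qed.

Lemma null_Dr1 : Dr1 r 0 1 null.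
Proof. exact: Dr1_eq0. Qed.

Lemma exact_continuation_rate : exists2 C : R, 0 <= C & forall n (x : R),
  (0 < n)%N -> 0 <= x <= 1 ->
  `|partial_sum b (splice (L F) f) x n - f x| <= C / n%:R ^+ r.+1.
Proof.
have [LD _ _ Lbd] := hL.
have m0 l : (l <= r)%N -> deriven_on (1 - b) 0 l (L F) 0 = deriven_on 0 1 l f 0.
  move=> lr; have [/= -> _] := Lbd F (Ordinal (lr : (l < r.+1)%N)).
  exact: boundary_data0.
have m1 l : (l <= r)%N -> deriven_on (1 - b) 0 l (L F) (1 - b) = deriven_on 0 1 l f 1.
  move=> lr; have [/= _ ->] := Lbd F (Ordinal (lr : (l < r.+1)%N)).
  exact: boundary_data1.
exact (splice_partial_sum_rate hb hr (leqnn r) (LD F) hf m0 m1).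
Qed.

Section UnitData.
Variables (j : 'I_2) (k : 'I_r.+1).
Hypothesis sk : (s < k)%N.

Lemma unit_data_match0 l : (l <= s)%N ->
  deriven_on (1 - b) 0 l (L (delta_mx j k)) 0 = deriven_on 0 1 l null 0.
Proof.
move=> ls; have [_ _ _ Lbd] := hL.
have lr : (l < r.+1)%N by rewrite ltnS (leq_trans ls)// ltnW.
rewrite deriven_on_null ?lexx ?ler01//.
have [/= -> _] := Lbd (delta_mx j k) (Ordinal lr).
by rewrite mxE -[X in _ && X]val_eqE/= ltn_eqF ?andbF// (leq_ltn_trans ls).
Qed.

Lemma unit_data_match1 l : (l <= s)%N ->
  deriven_on (1 - b) 0 l (L (delta_mx j k)) (1 - b) = deriven_on 0 1 l null 1.
Proof.
move=> ls; have [_ _ _ Lbd] := hL.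
have lr : (l < r.+1)%N by rewrite ltnS (leq_trans ls)// ltnW.
rewrite deriven_on_null ?lexx ?ler01//.
have [/= _ ->] := Lbd (delta_mx j k) (Ordinal lr).
by rewrite mxE -[X in _ && X]val_eqE/= ltn_eqF ?andbF// (leq_ltn_trans ls).
Qed.

Lemma unit_data_continuous :
  {within `[1 - b, 1], continuous (splice (L (delta_mx j k)) null)}.
Proof.
have [LD _ _ _] := hL.
exact (splice_continuous hb (LD _) null_Dr1 unit_data_match0).
Qed.

Lemma unit_data_rate : exists2 C : R, 0 <= C & forall n (x : R),
  (0 < n)%N -> 0 <= x <= 1 ->
  `|partial_sum b (splice (L (delta_mx j k)) null) x n| <= C / n%:R ^+ s.+1.
Proof.
have [LD _ _ _] := hL.
have [C C0 HC] := splice_partial_sum_rate hb hr (ltnW hs) (LD _) null_Dr1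
  unit_data_match0 unit_data_match1.
by exists C => // n x n0 x01; have := HC n x n0 x01; rewrite subr0.
Qed.

End UnitData.

(** The values at 0 of the two parts are entries of column 0 of [A] and [F]. *)
Lemma agree_continuous A : agree A -> {within `[1 - b, 1], continuous (splice (L A) f)}.
Proof.
move=> Aag; have [LD _ _ Lbd] := hL.
have m0 l : (l <= 0)%N -> deriven_on (1 - b) 0 l (L A) 0 = deriven_on 0 1 l f 0.
  rewrite leqn0 => /eqP->; have [/= -> _] := Lbd A ord0.
  by rewrite Aag// mxE.
exact (splice_continuous hb (LD A) hf m0).
Qed.

Lemma splice_comb (c : R) A B :
  {in `[1 - b, 1], forall t, splice (L (c *: A + B)) f t =
    c * splice (L A) null t + splice (L B) f t}.
Proof.
have [_ lin _ _] := hL => t; rewrite in_itv/= => /andP[bt t1].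
rewrite /splice; case: ltP => [t0|_]; last by rewrite mulr0 add0r.
by rewrite lin// in_itv/= bt ltW.
Qed.

(** The exact data give the term in [C2], the entries of [A - F] the term in
    [C1]. Only entries in columns above [s] occur, and there are finitely many of
    them, which is what makes [C1] independent of [A]. *)
Lemma approximate_continuation_rate : exists C1 C2 : R, [/\ 0 < C1, 0 < C2 &
  forall A, agree A -> forall n (x : R), (0 < n)%N -> 0 <= x <= 1 ->
  `|partial_sum b (splice (L A) f) x n - f x| <=
    C1 / n%:R ^+ s.+1 * mx_norm (A - F) + C2 / n%:R ^+ r.+1].
Proof.
have [C2 C20 HC2] := exact_continuation_rate.
have /fin_all_exists[C HC] : forall i : 'I_2 * 'I_r.+1, exists C : R, 0 <= C /\
    ((s < i.2)%N -> forall n (x : R), (0 < n)%N -> 0 <= x <= 1 ->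
     `|partial_sum b (splice (L (delta_mx i.1 i.2)) null) x n| <= C / n%:R ^+ s.+1).
  move=> [j k] /=; have [sk|ks] := ltnP s k; last by exists 0.
  by have [C C0 HC] := unit_data_rate j sk; exists C.
exists (\sum_i C i + 1), (C2 + 1); split; first by rewrite ltr_wpDl// sumr_ge0// => i _; have [] := HC i.
  by rewrite ltr_wpDl.
move=> A Aag n x n0 x01; pose D : 'M[R]_(2, r.+1) := A - F.
have n_gt0 m : 0 <= (n%:R ^+ m)^-1 :> R by rewrite invr_ge0 exprn_ge0.
(* Partial repairs of F towards A. Adding the entries of the error one by one
   keeps the data in agreement with F up to column s, hence keeps the spliced
   function continuous, as the linearity of partial sums requires. *)
pose B (e : seq ('I_2 * 'I_r.+1)) := F + \sum_(i <- e | (s < i.2)%N) D i.1 i.2 *: delta_mx i.1 i.2.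
have step e : agree (B e) /\ `|partial_sum b (splice (L (B e)) f) x n - f x| <=
    (\sum_(i <- e | (s < i.2)%N) C i * `|D i.1 i.2|) / n%:R ^+ s.+1 +
    C2 / n%:R ^+ r.+1.
  elim: e => [|i e [Bag ih]].
    by rewrite /B !big_nil addr0 mul0r add0r; split; [move=> ? ? ?|exact: HC2].
  rewrite /B !big_cons; case: ifP => si; last by split.
  rewrite addrCA -/(B e); split.
    move=> j k ks; rewrite mxE (Bag _ _ ks) -[RHS]add0r; congr (_ + _).
    rewrite !mxE -[X in _ && X]val_eqE/= ltn_eqF; first by rewrite andbF mulr0.
    exact: leq_ltn_trans si.
  rewrite (partial_sum_comb (unit_data_continuous (j := i.1) si)
    (agree_continuous Bag) (@splice_comb _ _ _)) -addrA mulrDl -addrA.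
  apply: le_trans (ler_normD _ _) _; apply: lerD => //.
  rewrite normrM mulrAC mulrC; apply: ler_wpM2r => //.
  by have [_] := HC i; exact.
have AB : A = B (index_enum _).
  rewrite /B -[LHS](subrKC F) -/D; congr (_ + _).
  rewrite [LHS]matrix_sum_delta pair_bigA/= [LHS](bigID (fun i : 'I_2 * 'I_r.+1 => (s < i.2)%N))/=.
  rewrite [X in _ + X]big1 ?addr0// => i; rewrite -leqNgt => si.
  by rewrite /D !mxE Aag// mxE subrr scale0r.
have [_] := step (index_enum _); rewrite -AB => /le_trans; apply.
apply: lerD; last by apply: ler_wpM2r => //; rewrite lerDl.
rewrite mulrAC; apply: ler_wpM2r => //.
have Dle i : `|D i.1 i.2| <= mx_norm D.
  by rewrite mx_normE -[leLHS]nngE num_le; exact: (le_bigmax _ (fun i => `|D i.1 i.2|%:nng)).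
apply: (@le_trans _ _ (\sum_i C i * mx_norm D)).
  rewrite big_mkcond/=; apply: ler_sum => i _.
  have [C0 _] := HC i.
  by case: ifP => _; [exact: ler_wpM2l|rewrite mulr_ge0// (le_trans _ (Dle i))].
rewrite -mulr_suml mulrDl lerDl mul1r.
by rewrite (le_trans _ (Dle (ord0, ord0))).
Qed.

End ContinuationError.

Section SupremumNorm.
Context {R : realType}.
Implicit Types h : R -> R.

Lemma normc_real (a : R) : Normc.normc a%:C = `|a|.
Proof. by rewrite /Normc.normc /= expr0n/= addr0 sqrtr_sqr. Qed.

Lemma supnorm_real_ge0_le h (M : R) : (forall x, 0 <= x <= 1 -> `|h x| <= M) ->
  0 <= supnorm 0 1 (fun x => (h x)%:C) <= M.
Proof.
move=> hM; rewrite /supnorm; set S := [set _ | _ in _].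
have ub : ubound S M.
  move=> _ [x xab <-]; rewrite normc_real; apply: hM.
  by move: xab; rewrite /= in_itv.
have S0 : S `|h 0| by exists 0; rewrite ?normc_real//= in_itv/= lexx ler01.
apply/andP; split; last by apply: ge_sup => //; exists `|h 0|.
by apply: (le_trans (normr_ge0 (h 0))); apply: ub_le_sup => //; exists M.
Qed.

End SupremumNorm.

Theorem theorem2p6 (R : realType) (r s : nat) (b : R) (f : R -> R)
    (L : 'M[R]_(2, r.+1) -> R -> R) (Fhat : nat -> 'M[R]_(2, r.+1))
    (hr : (1 <= r)%N) (hs : (s < r)%N) (hb : 1 < b)
    (hf : Dr1 r 0 1 f)
    (hL : continuation_operator b L)
    (hF : forall n, (1 <= n)%N -> s_exact s f (Fhat n)) :
  let F := boundary_data r f in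
  let errF := fun n : nat => mx_norm (Fhat n - F) in
  let errT := fun n : nat =>
    supnorm 0 1 (fun x =>
      fourier_trunc n b (continuation L f (Fhat n)) x - (f x)%:C) in
  [/\ (exists C1 C2 : R, [/\ 0 < C1, 0 < C2 &
        forall n, (1 <= n)%N ->
          errT n <= C1 / n%:R ^+ s.+1 * errF n + C2 / n%:R ^+ r.+1]),
      (forall p : R,
        errF =O_\oo (fun n : nat => (n%:R `^ p)^-1 : R) ->
        r%:R < p + s%:R ->
        errT =O_\oo (fun n : nat => (n%:R ^+ r.+1)^-1 : R)) &
      (forall p : R,
        errF =O_\oo (fun n : nat => (n%:R `^ p)^-1 : R) ->
        p + s%:R <= r%:R ->
        errT =O_\oo (fun n : nat => (n%:R `^ (p + s%:R + 1))^-1 : R))].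
Proof.
move=> F errF errT.
have [C1 [C2 [C10 C20 HC]]] := approximate_continuation_rate hr hs hb hf hL.
have bound n : (1 <= n)%N ->
    0 <= errT n <= C1 / n%:R ^+ s.+1 * errF n + C2 / n%:R ^+ r.+1.
  move=> n1; have [ag _] := hF n n1.
  have Aag (j : 'I_2) (k : 'I_r.+1) : (k <= s)%N -> Fhat n j k = F j k.
    by move=> ks; rewrite ag// mxE.
  have cA := agree_continuous hb hf hL Aag.
  rewrite /errT.
  have -> : (fun x => fourier_trunc n b (continuation L f (Fhat n)) x - (f x)%:C) =
      (fun x => (partial_sum b (splice (L (Fhat n)) f) x n - f x)%:C).
    apply/funext => x.
    rewrite (_ : continuation L f (Fhat n) = splice (L (Fhat n)) f)//.
    by rewrite (fourier_truncE x hb cA) rmorphB.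
  by apply: supnorm_real_ge0_le => x x01; exact: HC.
(* The power s.+1 from the first bound and the power p from the hypothesis on
   errF add up; which of p + s + 1 and r + 1 is smaller decides the rate. *)
have rate (p : R) : errF =O_\oo (fun n : nat => (n%:R `^ p)^-1 : R) ->
    exists2 K, 0 < K & \forall n \near \oo, [/\ (1 <= n)%N, 0 <= errT n &
      errT n <= K * (n%:R `^ (p + s%:R + 1))^-1 + C2 * (n%:R ^+ r.+1)^-1].
  move=> /eqO_exP[K K0 HK]; exists (C1 * K); first exact: mulr_gt0.
  near=> n.
  have n1 : (1 <= n)%N by near: n; exists 1%N.
  have nr0 : 0 < n%:R :> R by rewrite ltr0n.
  have HKn : `|errF n| <= K * `|(n%:R `^ p)^-1| by near: n.
  have /andP[e0 eB] := bound n n1.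
  split=> //; apply: le_trans eB _; rewrite lerD2r -!mulrA ler_wpM2l ?(ltW C10)//.
  have eF : errF n <= K * (n%:R `^ p)^-1.
    apply: le_trans (ler_norm _) _; apply: le_trans HKn _.
    by rewrite gtr0_norm// invr_gt0 powR_gt0.
  apply: (@le_trans _ _ ((n%:R ^+ s.+1)^-1 * (K * (n%:R `^ p)^-1))).
    by rewrite ler_wpM2l// invr_ge0 exprn_ge0// ltW.
  rewrite mulrCA -invfM -powR_mulrn ?(ltW nr0)// -powRD; last first.
    by rewrite (gt_eqF nr0) implybT.
  by rewrite -natr1 addrC addrA.
split.
- exists C1, C2; split=> // n n1.
  by have /andP[] := bound n n1.
- move=> p /rate[K K0 HK] prs; apply/eqO_exP.
  exists (K + C2); first exact: addr_gt0.
  apply: filterS HK => n [n1 e0 eB].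
  have nr1 : 1 <= n%:R :> R by rewrite ler1n.
  have nr0 : 0 < n%:R :> R by rewrite ltr0n.
  rewrite (ger0_norm e0); apply: le_trans eB _.
  rewrite [X in _ <= _ * X]gtr0_norm ?invr_gt0 ?exprn_gt0// mulrDl lerD2r.
  rewrite ler_wpM2l ?(ltW K0)// lef_pV2 ?posrE ?exprn_gt0 ?powR_gt0//.
  by rewrite -powR_mulrn ?(ltW nr0)// ler_powR// -natr1; lra.
- move=> p /rate[K K0 HK] prs; apply/eqO_exP.
  exists (K + C2); first exact: addr_gt0.
  apply: filterS HK => n [n1 e0 eB].
  have nr1 : 1 <= n%:R :> R by rewrite ler1n.
  have nr0 : 0 < n%:R :> R by rewrite ltr0n.
  rewrite (ger0_norm e0); apply: le_trans eB _.
  rewrite [X in _ <= _ * X]gtr0_norm ?invr_gt0 ?powR_gt0// mulrDl lerD2l.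
  rewrite ler_wpM2l ?(ltW C20)// lef_pV2 ?posrE ?exprn_gt0 ?powR_gt0//.
  by rewrite -powR_mulrn ?(ltW nr0)// ler_powR// -natr1; lra.
Unshelve. all: by end_near. Qed.
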